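(* Let $\{q_k:k\ge 0\}$ be a sequence of nonnegative numbers with $q_0>0$, let $Q_n=\sum_{k=0}^{n-1}q_k$, and let $t_n^{\kappa}f=\frac1{Q_n}\sum_{k=1}^{n}q_{n-k}S_k^{\kappa}f$ be the associated Nörlund means with respect to the Walsh–Kaczmarz system, with maximal operator $t^{*,\kappa}f=\sup_{n\ge 1}|t_n^{\kappa}f|$. (a) Suppose that either $\{q_k\}$ is non-increasing and satisfies $$\frac{q_0 n}{Q_n}=O(1)\quad\text{as } n\to\infty,$$ or $\{q_k\}$ is non-decreasing. Then $t^{*,\kappa}$ is bounded from the Hardy space $H_{1/2}(G)$ to the space $L_{1/2,\infty}(G)$. (b) Let $0<p<1/2$. Suppose that either $\{q_k\}$ is non-decreasing and satisfies $$\frac{q_0}{Q_n}\ge \frac1n\quad (n\ge 1),$$ or $\{q_k\}$ is non-increasing. Then there exists a martingale $f\in H_p(G)$ such that $$\sup_{n\ge 1}\frac{\|t_n^{\kappa}f\|_{L_{p,\infty}}}{\|f\|_{H_p}}=\infty .$$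
   Context: $\mathbf N=\{0,1,2,\dots\}$. $G=\prod_{k=0}^{\infty}\mathbb Z_2$ is the Walsh group: elements are $x=(x_0,x_1,\dots)$ with $x_k\in\{0,1\}$, the operation is coordinatewise addition mod 2, and $\mu$ is the normalized Haar (product) measure. Dyadic intervals: $I_n(x)=\{y\in G: y_i=x_i,\ 0\le i<n\}$, $I_0(x)=G$. $F_n$ is the $\sigma$-algebra generated by the dyadic intervals of measure $2^{-n}$. Rademacher functions: $r_k(x)=(-1)^{x_k}$. For $n\ge1$ with binary expansion $n=\sum_i n_i2^i$, $n_i\in\{0,1\}$, let $|n|=\max\{j:n_j\ne0\}$. Walsh–Kaczmarz functions: $\kappa_0=1$ and $\kappa_n(x)=r_{|n|}(x)\prod_{k=0}^{|n|-1}\big(r_{|n|-1-k}(x)\big)^{n_k}$ for $n\ge1$. Martingales $f=(f^{(n)},n\in\mathbf N)$ are taken with respect to $(F_n)$. $f^*=\sup_n|f^{(n)}|$, and for $0<p<\infty$, $H_p(G)$ is the space of martingales with $\|f\|_{H_p}:=\|f^*\|_p<\infty$, where $\|g\|_p^p=\int_G|g|^p\,d\mu$. Also $\|g\|_{L_{p,\infty}}^p=\sup_{\lambda>0}\lambda^p\mu(|g|>\lambda)$. An operator $T$ is bounded from $H_p$ to $L_{p,\infty}$ if there is a constant $C$ with $\|Tf\|_{L_{p,\infty}}\le C\|f\|_{H_p}$ for all $f\in H_p$. For a martingale $f$: $\widehat f^{\kappa}(i)=\lim_{n\to\infty}\int_G f^{(n)}\kappa_i\,d\mu$ and $S_M^{\kappa}f=\sum_{i=0}^{M-1}\widehat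 f^{\kappa}(i)\kappa_i$. *)

(* Defs.v *)
From HB Require Import structures.
From mathcomp Require Export all_boot all_order all_algebra.
From mathcomp Require Export all_classical all_reals all_analysis.
From mathcomp Require Import ring lra.
Export numFieldNormedType.Exports.

Set Implicit Arguments.
Unset Strict Implicit.
Unset Printing Implicit Defensive.

Import Order.TTheory GRing.Theory Num.Theory.
Local Open Scope classical_set_scope.
Local Open Scope ring_scope.

Definition dyadic_interval (n : nat) (x : nat -> bool) : set (nat -> bool) :=
  [set y | forall i, (i < n)%N -> y i = x i].

Definition dyadic_intervals (n : nat) : set (set (nat -> bool)) :=
  range (dyadic_interval n).

(* [bool] is the two-element ring, whose addition is exclusive or, so the
   pointwise addition of functions is coordinatewise addition mod 2.
   The measurable sets are those of the product (equivalently, Borel)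
   sigma-algebra. *)
Definition walsh_group : Type :=
  g_sigma_algebraType (\bigcup_n dyadic_intervals n).

HB.instance Definition _ := Measurable.on walsh_group.
HB.instance Definition _ := GRing.Zmodule.copy walsh_group (nat -> bool).

Definition is_haar (R : realType) (mu : probability walsh_group R) : Prop :=
  forall (a : walsh_group) (A : set walsh_group), measurable A ->
    mu [set a + x | x in A] = mu A.

(* The Haar measure exists: it is the law of the binary digits of a uniform
   random variable on [0, 1]. *)
Section haar_existence.
Variable R : realType.

Let Fixpoint approx (n : nat) (t : R) : R :=
  if n is m.+1 then
    2 * approx m t + ((2 * approx m t + 1) / 2 ^+ m.+1 <= t)%R%:R
  else 0.

Let digits (t : R) : nat -> bool :=
  fun n => (2 * approx n t + 1) / 2 ^+ n.+1 <= t.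

Let Fixpoint code (n : nat) (x : nat -> bool) : R :=
  if n is m.+1 then 2 * code m x + (x m)%:R else 0.

Let approx_code n x t : dyadic_interval n x (digits t) -> approx n t = code n x.
Proof.
elim: n => //= n IH h; rewrite IH; last by move=> i ni; apply: h; exact: ltnW.
by rewrite -(h n (ltnSn n)) /digits IH// => i ni; apply: h; exact: ltnW.
Qed.

Let mid n x : R := (2 * code n x + 1) / 2 ^+ n.+1.

Let digits_preS n x : digits @^-1` dyadic_interval n.+1 x =
  digits @^-1` dyadic_interval n x `&`
  (if x n then [set` `[mid n x, +oo[] else [set` `]-oo, mid n x[]).
Proof.
apply/seteqP; split => t /=.
  move=> h; have h' : dyadic_interval n x (digits t).
    by move=> i ni; apply: h; exact: ltnW.
  split=> //; have := h n (ltnSn n); rewrite /digits (approx_code h') => E.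
  by rewrite -E; case: ifPn; rewrite /= in_itv /= ?andbT ?leNgt ?negbK.
move=> [h' h] i; rewrite ltnS leq_eqVlt => /orP[/eqP ->|]; last exact: h'.
rewrite /digits (approx_code h'); case: (x n) h => /=; rewrite in_itv/= ?andbT //.
by rewrite ltNge => /negbTE.
Qed.

Let digits_measurable n x :
  measurable (digits @^-1` dyadic_interval n x : set R).
Proof.
elim: n => [|n IH].
  by rewrite (_ : _ @^-1` _ = setT)//; apply/seteqP; split=> //= t _ i.
by rewrite digits_preS; apply: measurableI => //; case: ifP.
Qed.

Let digits_itv n x : digits @^-1` dyadic_interval n x `&` [set` `[0, 1[ : interval R] =
  [set` `[code n x / 2 ^+ n, (code n x + 1) / 2 ^+ n[].
Proof.
elim: n => [|n IH].
  rewrite (_ : _ @^-1` _ = setT) ?setTI /= ?expr0 ?add0r ?divr1 //.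
  by apply/seteqP; split=> //= t _ i.
rewrite digits_preS setIAC IH /mid /=.
have p0 : 0 < 2 ^+ n :> R by rewrite exprn_gt0.
rewrite exprS; move: (2 ^+ n) p0 (code n x) => p p0 c.
have E1 : 2 * c / (2 * p) = c / p by field; rewrite gt_eqF.
have E2 : (2 * c + 1 + 1) / (2 * p) = (c + 1) / p by field; rewrite gt_eqF.
have L1 : c / p < (2 * c + 1) / (2 * p).
  by rewrite -E1 ltr_pM2r ?invr_gt0 ?mulr_gt0// ltrDl.
have L2 : (2 * c + 1) / (2 * p) < (c + 1) / p.
  by rewrite -E2 ltr_pM2r ?invr_gt0 ?mulr_gt0// ltrDl.
case: (x n); rewrite /= ?addr0 ?E1 ?E2; apply/seteqP; split => t /=;
  rewrite !in_itv /=; lra.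
Qed.

Let P : probability _ R := uniform_prob (@ltr01 R).

Let P_itv (a b : R) : 0 <= a -> a <= b -> b <= 1 -> P [set` `[a, b[] = (b - a)%:E.
Proof.
move=> a0 ab b1; rewrite /P /= /uniform_prob (eq_integral (cst 1%:E)).
  rewrite integral_cst//= lebesgue_measure_itv /= lte_fin mul1e EFinB.
  by case: ltgtP ab => // -> _; rewrite subee.
move=> t; rewrite inE /= in_itv /= /uniform_pdf => /andP[h1 h2].
by rewrite (le_trans a0 h1) (ltW (lt_le_trans h2 b1)) subr0 invr1.
Qed.

Let P_restr (A : set R) : measurable A -> P A = P (A `&` [set` `[0, 1[]).
Proof.
move=> mA; rewrite {1}(_ : A = (A `&` [set` `[0, 1[]) `|` (A `&` ~` [set` `[0, 1[])).
  rewrite measureU//; [|exact: measurableI|apply: measurableI => //; exact: measurableC|].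
  - rewrite [X in (_ + X)%E = _](_ : _ = 0%E) ?adde0//.
    apply/eqP; rewrite eq_le measure_ge0 andbT.
    rewrite (@le_trans _ _ (P (~` [set` `[0, 1[])))//.
      by apply: le_measure; rewrite ?inE//; [apply: measurableI => //|];
        exact: measurableC.
    by rewrite probability_setC// P_itv// subr0 subee.
  - by rewrite setIACA setICr setI0.
by rewrite -setIUr setUv setIT.
Qed.

Let mdigits : measurable_fun [set: R] (digits : R -> walsh_group).
Proof.
apply: (@measurability _ _ _ walsh_group setT _ (\bigcup_n dyadic_intervals n)) => //.
move=> _ [_ [n _ [x _ <-]] <-]; rewrite setTI; exact: digits_measurable.
Qed.

HB.instance Definition _ := isMeasurableFun.Build _ _ _ _
  (digits : measurableTypeR R -> walsh_group) mdigits.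

Let haar : probability walsh_group R :=
  distribution P (digits : measurableTypeR R -> walsh_group).

Let dyadic_measurable n x : measurable (dyadic_interval n x : set walsh_group).
Proof. by apply: sub_sigma_algebra; exists n => //; exists x. Qed.

Let code_bound n x : 0 <= code n x /\ code n x + 1 <= 2 ^+ n.
Proof.
elim: n => /= [|n [IH0 IH1]]; first by rewrite expr0 add0r.
by rewrite exprS; case: (x n) => /=; lra.
Qed.

Let haar_dyadic n x : haar (dyadic_interval n x) = (2 ^- n)%:E.
Proof.
have p0 : 0 < 2 ^+ n :> R by rewrite exprn_gt0.
have [c0 c1] := code_bound n x.
rewrite /haar /= /distribution /pushforward P_restr; last exact: digits_measurable.
rewrite digits_itv P_itv.
- by congr (_%:E); rewrite mulrDl addrAC subrr add0r mul1r.
- by rewrite divr_ge0// ltW.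
- by rewrite ler_pM2r ?invr_gt0// lerDl.
- by rewrite ler_pdivrMr// mul1r.
Qed.

Let shift_dyadic (a : walsh_group) n x :
  (fun y : walsh_group => a + y) @^-1` dyadic_interval n x =
  dyadic_interval n ((a : nat -> bool) + x).
Proof.
apply/seteqP; split => y /= h i ni; have := h i ni.
  move=> E; apply/esym.
  by apply: (etrans (congr1 (addb (a i)) (esym E))); exact: addKb.
by move=> E; apply: (etrans (congr1 (addb (a i)) E)); exact: addKb.
Qed.

Let shift_measurable (a : walsh_group) :
  measurable_fun [set: walsh_group] (fun y : walsh_group => a + y).
Proof.
apply: (@measurability _ _ _ walsh_group setT _ (\bigcup_n dyadic_intervals n)) => //.
by move=> _ [_ [n _ [x _ <-]] <-]; rewrite setTI shift_dyadic; exact: dyadic_measurable.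
Qed.

Lemma haar_exists : exists mu : probability walsh_group R, is_haar mu.
Proof.
exists haar => a A mA.
have -> : [set a + x | x in A] = (fun y : walsh_group => a + y) @^-1` A.
  have K (y : walsh_group) : a + (a + y) = y by apply/funext => i; exact: addKb.
  apply/seteqP; split => [_ [y Ay <-]|y Ay] /=; first by rewrite K.
  by exists (a + y); rewrite ?K.
pose f : {mfun walsh_group >-> walsh_group} :=
  HB.pack (fun y : walsh_group => a + y) (isMeasurableFun.Build _ _ _ _ _ (shift_measurable a)).
rewrite -[LHS]/(distribution haar f A).
apply: (@g_sigma_algebra_measure_unique _ R walsh_group
  (set0 |` \bigcup_n dyadic_intervals n) _ (fun=> setT)) => //.
- by move=> B [->//|[n _ [x _ <-]]]; exact: dyadic_measurable.
- by right; exists 0%N => //; exists point => //; apply/seteqP; split.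
- by rewrite bigcup_const.
- move=> B C [->|[m _ [x _ <-]]]; first by rewrite set0I; left.
  case=> [->|[n _ [y _ <-]]]; first by rewrite setI0; left.
  wlog mn : m n x y / (m <= n)%N.
    by move=> H; case: (leqP m n) => [|/ltnW] /H // /(_ y x); rewrite setIC.
  have [xy|xy] := pselect (dyadic_interval m x y).
    right; exists n => //; exists y => //; apply/seteqP; split => [z h|z [_ h]]//.
    by split=> // i im; rewrite h ?xy//; exact: leq_trans mn.
  left; apply/seteqP; split => // z [h1 h2]; apply: xy => i im.
  by rewrite -h1// h2//; exact: leq_trans mn.
- move=> B [->|[n _ [x _ <-]]]; first by rewrite !measure0.
  rewrite -[LHS]/(haar ((fun y : walsh_group => a + y) @^-1` dyadic_interval n x)).
  by rewrite shift_dyadic haar_dyadic; exact/esym/haar_dyadic.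
- by move=> _; rewrite (le_lt_trans (probability_le1 _ _))// ltry.
- by apply: sub_sigma_algebra2 mA; exact: subsetUr.
Qed.

End haar_existence.

Section walsh_kaczmarz.
Variable R : realType.

Definition rademacher (k : nat) (x : walsh_group) : R := (-1) ^+ x k.

Definition binary_digit (n i : nat) : bool := odd (n %/ 2 ^ i).

(* The largest j with n_j <> 0; since j < 2 ^ j <= n for such a j, the range
   j < n contains all of them. *)
Definition binary_order (n : nat) : nat :=
  (\max_(j < n | binary_digit n j) j)%N.

Definition kaczmarz (n : nat) (x : walsh_group) : R :=
  if n is 0 then 1 else
  rademacher (binary_order n) x *
  \prod_(0 <= k < binary_order n)
     rademacher (binary_order n - 1 - k) x ^+ binary_digit n k.

Variable mu : probability walsh_group R.

Definition dyadic_filtration (n : nat) : set (set walsh_group) :=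
  <<s dyadic_intervals n >>.

Definition is_martingale (f : nat -> walsh_group -> R) : Prop :=
  [/\ forall n, mu.-integrable [set: walsh_group] (EFin \o f n),
      forall n (B : set R), measurable B -> dyadic_filtration n (f n @^-1` B) &
      forall m n, (m <= n)%N -> forall A, dyadic_filtration m A ->
        (\int[mu]_(x in A) (f n x)%:E = \int[mu]_(x in A) (f m x)%:E)%E].

Definition martingale_max (f : nat -> walsh_group -> R) (x : walsh_group)
    : \bar R :=
  ereal_sup [set `|f n x|%:E | n in [set: nat]].

Definition Hp_norm (p : R) (f : nat -> walsh_group -> R) : \bar R :=
  'N[mu]_p%:E[martingale_max f].

Definition in_Hp (p : R) (f : nat -> walsh_group -> R) : Prop :=
  is_martingale f /\ (Hp_norm p f < +oo)%E.

Definition weak_Lp_norm (p : R) (g : walsh_group -> \bar R) : \bar R :=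
  (ereal_sup [set (l `^ p)%:E * mu [set x | l%:E < `|g x|]
              | l in [set l | (0 < l)%R]] `^ p^-1)%E.

Definition bounded_Hp_weak_Lp (p : R)
    (T : (nat -> walsh_group -> R) -> walsh_group -> \bar R) : Prop :=
  exists C : R, forall f, in_Hp p f ->
    (weak_Lp_norm p (T f) <= C%:E * Hp_norm p f)%E.

Definition kaczmarz_coef (f : nat -> walsh_group -> R) (i : nat) : R :=
  limn (fun n => \int[mu]_x (f n x * kaczmarz i x)).

Definition kaczmarz_sum (M : nat) (f : nat -> walsh_group -> R)
    (x : walsh_group) : R :=
  \sum_(0 <= i < M) kaczmarz_coef f i * kaczmarz i x.

Definition norlund_weight (q : nat -> R) (n : nat) : R :=
  \sum_(0 <= k < n) q k.

Definition norlund_mean (q : nat -> R) (n : nat) (f : nat -> walsh_group -> R)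
    (x : walsh_group) : R :=
  (norlund_weight q n)^-1 *
  \sum_(1 <= k < n.+1) q (n - k)%N * kaczmarz_sum k f x.

Definition norlund_max (q : nat -> R) (f : nat -> walsh_group -> R)
    (x : walsh_group) : \bar R :=
  ereal_sup [set `|norlund_mean q n f x|%:E | n in [set n | (1 <= n)%N]].

End walsh_kaczmarz.

(* Main.v *)
(* (a) By Abel summation, the Nörlund means are dominated by the Fejér means of
   the partial sums.  On the block [2 ^ i <= k < 2 ^ i.+1] the kernel of the
   partial sum is [D_(2 ^ i) + r_i * D], where [D] is a Walsh-Dirichlet kernel
   in the reversed first [i] variables; a recursion on [i] bounds the sums of
   these kernels by [2 ^ (a + b)], where [a] and [b] count the coordinates
   after the last, respectively the last but one, coordinate equal to [1] among
   the first [i] ones.  Divided by [2 ^ i], this weight is essentially a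
   supermartingale, hence convolving a piece of [f] that lives at level [n]
   with any such kernel amounts to convolving it with the weight of level [n].
   The law of the weight satisfies [P (weight > l) <= 3 / sqrt l].  A
   martingale is cut at the times at which its maximal function (roughly)
   doubles; the square roots of the sizes of the pieces then sum up to the
   [H_(1/2)] quasi-norm, and truncation makes weak [L_(1/2)] estimates
   summable.

   (b) Either hypothesis gives [Q_n <= n q_0].  For the martingale
   [sum_j c_j r_j D_(2 ^ j)], the mean of order [2 ^ n + 1] is at least
   [c_n / 2 ^ n.+1 - sum_(j < n) c_j 2 ^ j] in absolute value at every point.
   The coefficients are [0] except for very sparse levels, where [c_n] is
   [2 ^ (n (1 / p - 1))] times a geometric factor; since [1 / p - 2 > 0] the
   lower bound is unbounded. *)
Require Import Defs.
From mathcomp Require Import ring lra zify measurable_realfun.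

Set Implicit Arguments.
Unset Strict Implicit.
Unset Printing Implicit Defensive.

Import Order.TTheory GRing.Theory Num.Theory.
Local Open Scope classical_set_scope.
Local Open Scope ring_scope.

(** * Averages over finitely many coordinates *)

(** The working form of measurability with respect to [F_n]: dependence on the first [n] coordinates
    only. For sets, [filtration_cylinder] and [cylinder_filtration] give the equivalence. *)
Definition cylinder (T : Type) (n : nat) (g : walsh_group -> T) : Prop :=
  forall x y : walsh_group, dyadic_interval n x y -> g y = g x.

Definition coordv (k : nat) : walsh_group := fun i => i == k.

Lemma walsh_addE (x y : walsh_group) i : (x + y) i = x i (+) y i.
Proof. by []. Qed.

Lemma walsh_addK (x y : walsh_group) : x + (x + y) = y.
Proof. by apply/funext => i; exact: addKb. Qed.

Lemma coordv_ne k (x : walsh_group) i : i != k -> (x + coordv k) i = x i.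
Proof. by move=> ik; rewrite walsh_addE /coordv (negbTE ik) addbF. Qed.

Lemma coordv_eq k (x : walsh_group) : (x + coordv k) k = ~~ x k.
Proof. by rewrite walsh_addE /coordv eqxx addbT. Qed.

Lemma dyadic_coordv n k (x : walsh_group) : (n <= k)%N ->
  dyadic_interval n x (x + coordv k).
Proof. by move=> nk i ni; rewrite coordv_ne// ltn_eqF// (leq_trans ni). Qed.

Lemma dyadic_add n (a x y : walsh_group) :
  dyadic_interval n x y -> dyadic_interval n (a + x) (a + y).
Proof. by move=> xy i ni; rewrite !walsh_addE xy. Qed.

Lemma dyadic_addr n (a x y : walsh_group) :
  dyadic_interval n x y -> dyadic_interval n (x + a) (y + a).
Proof. by move=> xy i ni; rewrite !walsh_addE xy. Qed.

Section cylinder_theory.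
Variables T U V : Type.

Lemma cylinder_le m n (g : walsh_group -> T) : (m <= n)%N ->
  cylinder m g -> cylinder n g.
Proof. by move=> mn gm x y xy; apply: gm => i im; apply: xy; exact: leq_trans mn. Qed.

Lemma cylinder_comp n (g : walsh_group -> T) (h : T -> U) :
  cylinder n g -> cylinder n (h \o g).
Proof. by move=> gn x y xy /=; rewrite (gn x y). Qed.

Lemma cylinder_op2 n (op : T -> U -> V) g h :
  cylinder n g -> cylinder n h -> cylinder n (fun x => op (g x) (h x)).
Proof. by move=> gn hn x y xy /=; rewrite (gn x y)// (hn x y). Qed.

Lemma cylinder_shift n (a : walsh_group) (g : walsh_group -> T) :
  cylinder n g -> cylinder n (fun x => g (a + x)).
Proof. by move=> gn x y xy; apply: gn; exact: dyadic_add. Qed.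

Lemma cylinder_shiftr n (a : walsh_group) (g : walsh_group -> T) :
  cylinder n g -> cylinder n (fun x => g (x + a)).
Proof. by move=> gn x y xy; apply: gn; exact: dyadic_addr. Qed.

Lemma cylinder_coordv n k (g : walsh_group -> T) x : cylinder n g -> (n <= k)%N ->
  g (x + coordv k) = g x.
Proof. by move=> gn nk; apply: gn; exact: dyadic_coordv. Qed.

(** Once the first [n] coordinates are fixed, [g] takes at most two values, at [x] and at
    [x + coordv n]; changing coordinate [n] swaps them, and a commutative [op] does not see the
    swap. *)
Lemma cylinder_sym n (op : T -> T -> U) (g : walsh_group -> T) :
  commutative op -> cylinder n.+1 g ->
  cylinder n (fun x => op (g x) (g (x + coordv n))).
Proof.
move=> opC gn x y xy.
have H z t : dyadic_interval n z t -> t n = z n -> g t = g z.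
  move=> zt E; apply: gn => i; rewrite ltnS leq_eqVlt => /orP[/eqP->//|].
  exact: zt.
have [E|E] := boolP (y n == x n).
  by rewrite (H x y)// ?(eqP E)// (H _ _ (dyadic_addr (coordv n) xy))// !coordv_eq (eqP E).
have {}E : y n = ~~ x n by case: (y n) (x n) E => [] [].
rewrite opC; congr op; apply: H.
- by move=> i ni; rewrite coordv_ne ?ltn_eqF// xy.
- by rewrite coordv_eq E negbK.
- by move=> i ni; rewrite coordv_ne ?ltn_eqF// xy.
- by rewrite coordv_eq E.
Qed.

End cylinder_theory.

Section averages.
Variable R : realType.
Implicit Types g h : walsh_group -> R.

(** On functions of the first [k.+1] coordinates this is the conditional expectation given [F_k]. *)
Definition flip_avg (k : nat) g (x : walsh_group) : R :=
  (g x + g (x + coordv k)) / 2.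

Fixpoint avg (m : nat) g : walsh_group -> R :=
  if m is k.+1 then avg k (flip_avg k g) else g.

(* For [g] depending on the first [m] coordinates only, this is the integral
   of [g]. *)
Definition mean (m : nat) g : R := avg m g 0.

Lemma cylinder_flip_avg m g : cylinder m.+1 g -> cylinder m (flip_avg m g).
Proof.
move=> gm; apply: (@cylinder_sym _ _ _ (fun a b => (a + b) / 2)) gm => a b.
by rewrite addrC.
Qed.

Lemma flip_avg_id n k g : cylinder n g -> (n <= k)%N -> flip_avg k g = g.
Proof.
move=> gn nk; apply/funext => x; rewrite /flip_avg (cylinder_coordv _ gn)//.
by field.
Qed.

Lemma flip_avgM n k g h : cylinder n g -> (n <= k)%N ->
  flip_avg k (fun x => g x * h x) = fun x => g x * flip_avg k h x.
Proof.
move=> gn nk; apply/funext => x; rewrite /flip_avg (cylinder_coordv _ gn)//.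
by ring.
Qed.

Lemma flip_avg_shift k a g :
  flip_avg k (fun x => g (a + x)) = fun x => flip_avg k g (a + x).
Proof. by apply/funext => x; rewrite /flip_avg addrA. Qed.

Lemma avg_shift m a g x : avg m (fun x => g (a + x)) x = avg m g (a + x).
Proof. by elim: m g x => //= m IH g x; rewrite flip_avg_shift IH. Qed.

Lemma avg_cst m g x y : cylinder m g -> avg m g x = avg m g y.
Proof.
elim: m g x y => /= [|m IH] g x y gm; first by apply: gm.
by apply: IH; exact: cylinder_flip_avg.
Qed.

Lemma mean_shift m a g : cylinder m g -> mean m (fun x => g (a + x)) = mean m g.
Proof. by move=> gm; rewrite /mean avg_shift; exact: avg_cst. Qed.

Lemma mean_shiftr m a g : cylinder m g -> mean m (fun x => g (x + a)) = mean m g.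
Proof.
move=> gm; rewrite -[RHS](mean_shift a)//; congr mean.
by apply/funext => x; rewrite addrC.
Qed.

Lemma mean_stable n m g : cylinder n g -> (n <= m)%N -> mean m g = mean n g.
Proof.
move=> gn; elim: m => [|m IH]; first by rewrite leqn0 => /eqP->.
rewrite leq_eqVlt => /orP[/eqP->//|nm].
by rewrite /mean /= (flip_avg_id gn)//; exact: IH.
Qed.

Lemma meanS m g : mean m.+1 g = mean m (flip_avg m g).
Proof. by []. Qed.

Lemma mean_sum (I : Type) (r : seq I) (P : pred I) m (F : I -> walsh_group -> R) :
  mean m (fun x => \sum_(i <- r | P i) F i x) = \sum_(i <- r | P i) mean m (F i).
Proof.
rewrite /mean; elim: m F => //= m IH F; rewrite -IH; congr avg; apply/funext => x.
by rewrite /flip_avg -big_split/= mulr_suml.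
Qed.

Lemma meanD m g h : mean m (fun x => g x + h x) = mean m g + mean m h.
Proof.
rewrite /mean; elim: m g h => //= m IH g h; rewrite -IH; congr avg.
by apply/funext => x; rewrite /flip_avg; ring.
Qed.

Lemma meanZ m c g : mean m (fun x => c * g x) = c * mean m g.
Proof.
rewrite /mean; elim: m g => //= m IH g; rewrite -IH; congr avg.
by apply/funext => x; rewrite /flip_avg; ring.
Qed.

Lemma mean_cst m c : mean m (fun=> c) = c.
Proof. by rewrite (@mean_stable 0 m). Qed.

Lemma ler_mean m g h : (forall x, g x <= h x) -> mean m g <= mean m h.
Proof.
rewrite /mean; elim: m g h => //= m IH g h gh; apply: IH => x.
by rewrite /flip_avg ler_pM2r ?invr_gt0// lerD.
Qed.

Lemma mean_ge0 m g : (forall x, 0 <= g x) -> 0 <= mean m g.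
Proof. by move=> g0; rewrite -(mean_cst m 0); exact: ler_mean. Qed.

Lemma ler_norm_mean m g : `|mean m g| <= mean m (fun x => `|g x|).
Proof.
rewrite ler_norml -mulN1r -meanZ; apply/andP; split; apply: ler_mean => x.
  by rewrite mulN1r lerNl -normrN ler_norm.
exact: ler_norm.
Qed.

(** The right side is the sum of the [2 ^ m] values of [g], each of which is nonnegative. *)
Lemma ler_mean_pt m g x : (forall x, 0 <= g x) -> cylinder m g ->
  g x <= 2 ^+ m * mean m g.
Proof.
rewrite /mean => g0 gm; rewrite (avg_cst 0 x gm).
elim: m g x g0 gm => /= [|m IH] g x g0 gm; first by rewrite mul1r.
have H : flip_avg m g x <= 2 ^+ m * avg m (flip_avg m g) x.
  apply: IH; last exact: cylinder_flip_avg.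
  by move=> y; rewrite divr_ge0// addr_ge0.
rewrite exprS -mulrA -ler_pdivrMl//; apply: le_trans H.
by rewrite mulrC ler_pM2r ?invr_gt0// lerDl.
Qed.

Lemma mean_flip_avg k m g : (k < m)%N -> cylinder m g ->
  mean m (flip_avg k g) = mean m g.
Proof.
move=> km gm.
have -> : flip_avg k g = fun x => 2^-1 * (g x + g (x + coordv k)).
  by apply/funext => x; rewrite /flip_avg mulrC.
rewrite meanZ meanD mean_shiftr//.
by field.
Qed.

Lemma mean_exchange m n (F : walsh_group -> walsh_group -> R) :
  mean m (fun x => mean n (F x)) = mean n (fun t => mean m (F^~ t)).
Proof.
elim: n F => // n IH F.
rewrite meanS; under eq_fun do rewrite meanS.
rewrite IH; congr mean; apply/funext => t; rewrite /flip_avg -meanD.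
rewrite [RHS]mulrC -meanZ; congr mean; apply/funext => x; by rewrite mulrC.
Qed.

(** Orthogonality of a martingale difference [g] at step [j] to everything known at time [j]. *)
Lemma mean_odd j m g h : (j < m)%N -> cylinder j h -> cylinder j.+1 g ->
  (forall x, flip_avg j g x = 0) -> mean m (fun x => h x * g x) = 0.
Proof.
move=> jm hj gj g0; rewrite (@mean_stable j.+1)//; last first.
  by apply: cylinder_op2 => //; exact: (cylinder_le (leqnSn j)).
rewrite meanS (flip_avgM _ hj)// -[RHS](mean_cst j); congr mean.
by apply/funext => x; rewrite g0 mulr0.
Qed.

End averages.

(** * Kernels *)

Lemma binary_digit_double (b : bool) j k :
  binary_digit (j.*2 + b) k.+1 = binary_digit j k.
Proof.
rewrite /binary_digit expnS divnMA; congr (odd (_ %/ _)).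
by rewrite divn2 halfD odd_double doubleK; case: b; rewrite /= ?addn0.
Qed.

Lemma binary_digit_double0 (b : bool) j : binary_digit (j.*2 + b) 0 = b.
Proof. by rewrite /binary_digit expn0 divn1 oddD odd_double; case: b. Qed.

Lemma binary_digit_small j k : (j < 2 ^ k)%N -> binary_digit j k = false.
Proof. by move=> jk; rewrite /binary_digit divn_small. Qed.

Lemma binary_digit_block i j k : (k < i)%N ->
  binary_digit (2 ^ i + j) k = binary_digit j k.
Proof.
move=> ki; rewrite /binary_digit -(subnK (ltnW ki)) expnD divnMDl ?expn_gt0//.
by rewrite oddD oddX/= subn_eq0 leqNgt ki.
Qed.

Lemma binary_order_block i j : (j < 2 ^ i)%N -> binary_order (2 ^ i + j) = i.
Proof.
move=> ji; rewrite /binary_order; apply/eqP; rewrite eqn_leq; apply/andP; split.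
  apply/bigmax_leqP => k; apply: contraLR; rewrite -ltnNge => ik.
  rewrite binary_digit_small// (@leq_trans (2 ^ i.+1))//; last first.
    by rewrite leq_exp2l.
  by rewrite expnS mul2n -addnn ltn_add2l.
have ii : (i < 2 ^ i + j)%N by rewrite (leq_trans (ltn_expl i (ltnSn 1)))// leq_addr.
apply: (@leq_bigmax_cond _ _ (fun k : 'I_(2 ^ i + j) => k : nat) (Ordinal ii)) => /=.
by rewrite /binary_digit divnDl ?dvdnn// divnn expn_gt0/= divn_small.
Qed.

Section kernels.
Variable R : realType.
Implicit Types (x z : walsh_group).

Local Notation rad := (rademacher R).

Lemma radE k x : rad k x = if x k then -1 else 1.
Proof. by rewrite /rademacher; case: (x k); rewrite /= ?expr1 ?expr0. Qed.

Lemma rad_norm k x : `|rad k x| = 1.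
Proof. by rewrite radE; case: (x k); rewrite ?normrN normr1. Qed.

Lemma rad_add k x y : rad k (x + y) = rad k x * rad k y.
Proof. by rewrite !radE walsh_addE; case: (x k); case: (y k) => /=; ring. Qed.

Lemma cylinder_rad k n : (k < n)%N -> cylinder n (rad k).
Proof. by move=> kn x y xy; rewrite !radE xy. Qed.

Lemma rad_flip_avg k x : flip_avg k (rad k) x = 0.
Proof. by rewrite /flip_avg !radE coordv_eq; case: (x k) => /=; ring. Qed.

(** What remains of the Kaczmarz function of index [2 ^ i + j] once its factor [r_i] is removed: a
    Walsh function in the first [i] variables taken in reverse order. *)
Definition psi (i j : nat) x : R :=
  \prod_(0 <= k < i) rad (i - 1 - k) x ^+ binary_digit j k.

(** Because of the reversed order, the lowest bit of the index governs the last variable. Halving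
    the index thus removes the last variable, which drives all recursions on [i] below. *)
Lemma psi_double i (b : bool) j x :
  psi i.+1 (j.*2 + b) x = rad i x ^+ b * psi i j x.
Proof.
rewrite /psi big_nat_recl// binary_digit_double0 subn0 subn1 /=; congr (_ * _).
apply: eq_bigr => k _; rewrite binary_digit_double.
by have -> : (i - k.+1 = i - 1 - k)%N by lia.
Qed.

Lemma psi_even i j x : psi i.+1 j.*2 x = psi i j x.
Proof. by rewrite -(mul1r (psi i j x)) -(psi_double i false) addn0. Qed.

Lemma psi_odd i j x : psi i.+1 j.*2.+1 x = rad i x * psi i j x.
Proof. by rewrite -(psi_double i true) addn1. Qed.

Lemma psi_add i j x y : psi i j (x + y) = psi i j x * psi i j y.
Proof.
by rewrite /psi -big_split; apply: eq_bigr => k _; rewrite rad_add exprMn.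
Qed.

Lemma psi_norm i j x : `|psi i j x| = 1.
Proof.
rewrite /psi normr_prod big1// => k _; by rewrite normrX rad_norm expr1n.
Qed.

Lemma cylinder_psi i j : cylinder i (psi i j).
Proof.
move=> x y xy; apply: eq_big_nat => k /andP[_ ki]; rewrite (cylinder_rad _ xy)//.
by lia.
Qed.

Lemma psi0 i j : psi i j 0 = 1.
Proof.
by rewrite /psi big1// => k _; rewrite (_ : rad _ 0 = 1) ?expr1n// radE.
Qed.

Lemma kaczmarz_block i j x : (j < 2 ^ i)%N ->
  kaczmarz R (2 ^ i + j) x = rad i x * psi i j x.
Proof.
move=> ji; have E := binary_order_block ji; move: (binary_digit_block (i := i) j).
have : (0 < 2 ^ i + j)%N by rewrite addn_gt0 expn_gt0.
case: (2 ^ i + j)%N E => [|n]// E _.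
move=> H; rewrite /kaczmarz E; congr (_ * _).
by apply: eq_big_nat => k /andP[_ ki]; rewrite H.
Qed.

Lemma nat_block n : (0 < n)%N -> exists i j, (j < 2 ^ i)%N /\ n = (2 ^ i + j)%N.
Proof.
move=> n0; exists (trunc_log 2 n), (n - 2 ^ trunc_log 2 n)%N.
have /andP[] := trunc_log_bounds (ltnSn 1) n0; rewrite expnS.
by move: (2 ^ _)%N => t; lia.
Qed.

Lemma kaczmarz_add n x y : kaczmarz R n (x + y) = kaczmarz R n x * kaczmarz R n y.
Proof.
case: (posnP n) => [->|/nat_block[i [j [ji ->]]]]; first by rewrite /= mulr1.
by rewrite !kaczmarz_block// rad_add psi_add; ring.
Qed.

Lemma kaczmarz_norm n x : `|kaczmarz R n x| = 1.
Proof.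
case: (posnP n) => [->|/nat_block[i [j [ji ->]]]]; first by rewrite /= normr1.
by rewrite kaczmarz_block// normrM rad_norm psi_norm mulr1.
Qed.

Lemma cylinder_kaczmarz N n : (n < 2 ^ N)%N -> cylinder N (kaczmarz R n).
Proof.
case: (posnP n) => [->//|/nat_block[i [j [ji ->]]]] nN x y xy.
have iN : (i < N)%N.
  by rewrite -(ltn_exp2l _ _ (ltnSn 1)) (leq_ltn_trans _ nN)// leq_addr.
rewrite !kaczmarz_block// (cylinder_rad iN xy).
by rewrite (cylinder_le (ltnW iN) (@cylinder_psi i j) xy).
Qed.

Definition psi_sum (i l : nat) x : R := \sum_(0 <= j < l) psi i j x.

Definition psi_sum2 (i m : nat) x : R := \sum_(0 <= l < m) psi_sum i l x.

Lemma psi_sum_double i l x :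
  psi_sum i.+1 l.*2 x = (1 + rad i x) * psi_sum i l x.
Proof.
rewrite /psi_sum; elim: l => [|l IH]; first by rewrite !big_geq// mulr0.
rewrite doubleS !big_nat_recr//= IH psi_even psi_odd; ring.
Qed.

Lemma psi_sumS i l x : psi_sum i l.+1 x = psi_sum i l x + psi i l x.
Proof. by rewrite /psi_sum big_nat_recr. Qed.

Lemma psi_sum2S i m x : psi_sum2 i m.+1 x = psi_sum2 i m x + psi_sum i m x.
Proof. by rewrite /psi_sum2 big_nat_recr. Qed.

Lemma psi_sum2_double i m x :
  psi_sum2 i.+1 m.*2 x = 2 * (1 + rad i x) * psi_sum2 i m x + psi_sum i m x.
Proof.
elim: m => [|m IH]; first by rewrite /psi_sum2 /psi_sum !big_geq// mulr0 addr0.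
rewrite doubleS !psi_sum2S !psi_sumS IH psi_sum_double psi_even; ring.
Qed.

(* [gap1 n x = 2 ^ a] and [gap2 n x = 2 ^ b], where [a] and [b] are the
   numbers of coordinates of index [< n] lying to the right of the last,
   respectively the last but one, coordinate of [x] equal to [1] among the
   first [n] ones ([n] itself if there is no such coordinate). *)
Fixpoint gap1 (n : nat) x : R :=
  if n is m.+1 then if x m then 1 else 2 * gap1 m x else 1.

Fixpoint gap2 (n : nat) x : R :=
  if n is m.+1 then if x m then 2 * gap1 m x else 2 * gap2 m x else 1.

Definition gap_prod n x : R := gap1 n x * gap2 n x.

Lemma gap1_ge1 n x : 1 <= gap1 n x.
Proof. by elim: n => //= n IH; case: (x n) => //; lra. Qed.

Lemma gap12 n x : gap1 n x <= gap2 n x.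
Proof.
elim: n => //= n IH; have := gap1_ge1 n x.
by case: (x n) => //; lra.
Qed.

Lemma gap2_ge1 n x : 1 <= gap2 n x.
Proof. exact: le_trans (gap1_ge1 n x) (gap12 n x). Qed.

Lemma cylinder_gap1 n : cylinder n (gap1 n).
Proof.
elim: n => //= n IH x y xy; rewrite xy// (IH x y)// => i ni.
by apply: xy; exact: ltnW.
Qed.

Lemma cylinder_gap2 n : cylinder n (gap2 n).
Proof.
elim: n => //= n IH x y xy.
have xy' : dyadic_interval n x y by move=> i ni; apply: xy; exact: ltnW.
by rewrite xy// (IH x y)// (cylinder_gap1 xy').
Qed.

Lemma cylinder_gap_prod n : cylinder n (gap_prod n).
Proof. exact: cylinder_op2 (@cylinder_gap1 n) (@cylinder_gap2 n). Qed.

Lemma gap_prodS n x :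
  gap_prod n.+1 x = if x n then 2 * gap1 n x else 4 * gap_prod n x.
Proof. by rewrite /gap_prod /=; case: (x n); ring. Qed.

Lemma gap_prod_ge n x : gap1 n x <= gap_prod n x.
Proof.
rewrite /gap_prod ler_peMr ?gap2_ge1//.
by rewrite (le_trans ler01 (gap1_ge1 _ _)).
Qed.

Lemma gap_prod_ge1 n x : 1 <= gap_prod n x.
Proof. exact: le_trans (gap1_ge1 n x) (gap_prod_ge n x). Qed.

Lemma half_split (m : nat) : exists k (b : bool), m = (k.*2 + b)%N.
Proof. by exists m./2, (odd m); rewrite addnC odd_double_half. Qed.

(** The bound reproduces itself under the recursion: the factor [1 + r_i] is [0] or [2] and an odd
    [l] adds one term of modulus [1]. For [x i] true this gives [1], for [x i] false
    [2 * (2 * gap1 - 1) + 1]. *)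
Lemma psi_sum_le i l x : (l <= 2 ^ i)%N -> `|psi_sum i l x| <= 2 * gap1 i x - 1.
Proof.
elim: i l => [|i IH] l.
  rewrite expn0; case: l => [|[]]// _; first by rewrite /psi_sum big_geq// normr0 /=; lra.
  by rewrite /psi_sum big_nat1 psi_norm/=; lra.
have [k [b ->]] := half_split l; rewrite expnS => kb.
have {}IH : `|psi_sum i k x| <= 2 * gap1 i x - 1 by apply: IH; lia.
have H (u : R) : `|(1 + rad i x) * psi_sum i k x + u| <=
    (if x i then 0 else 2 * (2 * gap1 i x - 1)) + `|u|.
  rewrite (le_trans (ler_normD _ _))// lerD2r normrM radE; case: (x i).
    by rewrite subrr normr0 mul0r.
  by rewrite ger0_norm ?ler_pM2l//; lra.
have := H (if b then psi i k x else 0).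
have -> : (1 + rad i x) * psi_sum i k x + (if b then psi i k x else 0) =
  psi_sum i.+1 (k.*2 + b) x.
  case: b {kb}; last by rewrite !addn0 psi_sum_double addr0.
  by rewrite addn1 psi_sumS psi_sum_double psi_even.
have : `|if b then psi i k x else 0| <= 1 by case: b {kb}; rewrite ?psi_norm ?normr0.
by rewrite /=; case: (x i); lra.
Qed.

(** Subtracting [3 * gap1] makes room for the first order sums. With [P] for [gap_prod] and [g] for
    [gap1], the case [x i] false needs [4 * (3 * P - 3 * g) + 3 * (2 * g - 1) <= 12 * P - 6 * g]; if
    [x i] is true, only [psi_sum] survives. *)
Lemma psi_sum2_le i m x : (m <= 2 ^ i)%N ->
  `|psi_sum2 i m x| <= 3 * gap_prod i x - 3 * gap1 i x.
Proof.
elim: i m => [|i IH] m.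
  rewrite expn0 /gap_prod /= mulr1 subrr normr_le0 => m1; apply/eqP.
  rewrite /psi_sum2; case: m m1 => [|[]]// _; first by rewrite big_geq.
  by rewrite big_nat1 /psi_sum big_geq.
have [k [b ->]] := half_split m; rewrite expnS => kb.
have {}IH : `|psi_sum2 i k x| <= 3 * gap_prod i x - 3 * gap1 i x by apply: IH; lia.
have D : `|psi_sum i k x| <= 2 * gap1 i x - 1 by apply: psi_sum_le; lia.
have -> : psi_sum2 i.+1 (k.*2 + b) x =
    (1 + rad i x) * (2 * psi_sum2 i k x + b%:R * psi_sum i k x) + psi_sum i k x.
  case: b {kb}; rewrite ?addn0 ?addn1 ?psi_sum2S psi_sum2_double /= ?psi_sum_double; ring.
rewrite radE gap_prodS /=; have := gap1_ge1 i x; case: (x i).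
  by rewrite subrr mul0r add0r; lra.
move=> g1; rewrite (le_trans (ler_normD _ _))//.
have : `|(1 + 1) * (2 * psi_sum2 i k x + b%:R * psi_sum i k x)| <=
   2 * (2 * `|psi_sum2 i k x| + `|psi_sum i k x|).
  rewrite normrM ger0_norm; last by lra.
  rewrite -[1 + 1]/(2 : R) ler_pM2l// (le_trans (ler_normD _ _))// !normrM.
  rewrite (ger0_norm (ler0n _ 2)) lerD2l normr_nat ler_piMl//.
  by case: b {kb}.
lra.
Qed.

(** * Kaczmarz-Dirichlet kernels and their sums over a dyadic block *)

Definition kaczmarz_dirichlet (n : nat) x : R := \sum_(0 <= i < n) kaczmarz R i x.

Lemma kaczmarz_dirichletD i l x : (l <= 2 ^ i)%N ->
  kaczmarz_dirichlet (2 ^ i + l) x =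
  kaczmarz_dirichlet (2 ^ i) x + rad i x * psi_sum i l x.
Proof.
elim: l => [|l IH] li; first by rewrite addn0 /psi_sum big_geq// mulr0 addr0.
rewrite addnS psi_sumS mulrDr addrA -IH ?(ltnW li)// -kaczmarz_block//.
by rewrite /kaczmarz_dirichlet big_nat_recr.
Qed.

Lemma kaczmarz_dirichlet_pow2 i x :
  kaczmarz_dirichlet (2 ^ i) x = psi_sum i (2 ^ i) x.
Proof.
elim: i => [|i IH].
  by rewrite /kaczmarz_dirichlet /psi_sum !big_nat1 /psi big_geq.
rewrite expnS mul2n psi_sum_double -addnn kaczmarz_dirichletD// IH; ring.
Qed.

(** The kernel of order [2 ^ i] equals [2 ^ i] on the dyadic interval of level [i] around [0], where
    [gap_prod] is [4 ^ i], and vanishes elsewhere. *)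
Lemma dirichlet_pow2_le i x :
  2 ^+ i * `|kaczmarz_dirichlet (2 ^ i) x| <= gap_prod i x.
Proof.
rewrite kaczmarz_dirichlet_pow2; elim: i => [|i IH].
  by rewrite /psi_sum big_nat1 psi_norm /gap_prod /= !mulr1.
rewrite expnS mul2n psi_sum_double normrM exprS gap_prodS radE.
case: (x i); first by rewrite subrr normr0 mul0r mulr0 mulr_ge0// (le_trans ler01 (gap1_ge1 _ _)).
by rewrite ger0_norm; lra.
Qed.

Definition block_kernel i m x : R :=
  \sum_(0 <= l < m) kaczmarz_dirichlet (2 ^ i + l) x.

(** The block sum is [m] copies of the kernel of order [2 ^ i], bounded by one [gap_prod], plus
    [r_i] times [psi_sum2], bounded by three. *)
Lemma block_kernel_le i m x : (m <= 2 ^ i)%N ->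
  `|block_kernel i m x| <= 4 * gap_prod i x.
Proof.
move=> mi; have -> : block_kernel i m x =
    m%:R * kaczmarz_dirichlet (2 ^ i) x + rad i x * psi_sum2 i m x.
  rewrite /block_kernel /psi_sum2; elim: m mi => [|m IH] mi.
    by rewrite !big_geq// mul0r mulr0 addr0.
  rewrite !big_nat_recr//= IH ?(ltnW mi)// kaczmarz_dirichletD ?(ltnW mi)//.
  by rewrite -natr1; ring.
rewrite (le_trans (ler_normD _ _))// !normrM rad_norm mul1r.
have H1 := psi_sum2_le x mi.
have H2 : `|m%:R| * `|kaczmarz_dirichlet (2 ^ i) x| <= gap_prod i x.
  apply: le_trans (dirichlet_pow2_le i x); rewrite ler_wpM2r// normr_nat.
  by rewrite -natrX ler_nat.
by have := gap1_ge1 i x; lra.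
Qed.

(** Averaging the last variable turns [gap_prod] into [2 * gap_prod + gap1] and [gap1] into
    [gap1 + 1/2]. The two added terms absorb these errors, so that this weight divided by [2 ^ n] is
    a supermartingale. *)
Definition gap_lyapunov n x : R := gap_prod n x + gap1 n x + 1.

Lemma gap_lyapunov_flip_avg n x :
  flip_avg n (gap_lyapunov n.+1) x <= 2 * gap_lyapunov n x.
Proof.
have E : flip_avg n (gap_lyapunov n.+1) x =
    (2 * gap1 n x + 4 * gap_prod n x + 2 * gap1 n x + 1 + 2) / 2.
  rewrite /flip_avg /gap_lyapunov !gap_prodS /= coordv_eq.
  rewrite /gap_prod !(cylinder_coordv _ (@cylinder_gap1 n))//.
  rewrite !(cylinder_coordv _ (@cylinder_gap2 n))//.
  by case: (x n) => /=; congr (_ / _); ring.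
by rewrite E /gap_lyapunov; lra.
Qed.

(** Since [u] depends on the first [N] variables only, the later ones are averaged out of the weight
    alone, each at the cost of a factor [2]. The factor [3] compares [gap_lyapunov] with
    [gap_prod]. *)
Lemma mean_gap_prod N i (u : walsh_group -> R) x :
  cylinder N u -> (forall t, 0 <= u t) -> (N <= i)%N ->
  mean i (fun t => u t * gap_prod i (x + t)) <=
  3 * 2 ^+ (i - N) * mean N (fun t => u t * gap_prod N (x + t)).
Proof.
move=> uN u0 Ni.
have H : mean i (fun t => u t * gap_lyapunov i (x + t)) <=
    2 ^+ (i - N) * mean N (fun t => u t * gap_lyapunov N (x + t)).
  rewrite -(subnK Ni) addnK; elim: (i - N)%N => [|d IH]; first by rewrite mul1r.
  rewrite addSn meanS (flip_avgM _ uN) ?leq_addl// exprS -mulrA.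
  apply: (@le_trans _ _ (2 * mean (d + N) (fun t => u t * gap_lyapunov (d + N) (x + t)))).
    rewrite -meanZ; apply: ler_mean => t.
    rewrite (flip_avg_shift _ x) [leRHS]mulrCA; apply: ler_wpM2l => //.
    exact: gap_lyapunov_flip_avg.
  by rewrite ler_pM2l.
apply: le_trans (_ : mean i (fun t => u t * gap_lyapunov i (x + t)) <= _).
  apply: ler_mean => t; apply: ler_wpM2l => //; rewrite /gap_lyapunov -addrA lerDl.
  by have := gap1_ge1 i (x + t); lra.
apply: (le_trans H); rewrite -mulrA mulrCA ler_pM2l ?exprn_gt0// -meanZ.
apply: ler_mean => t; rewrite [leRHS]mulrCA; apply: ler_wpM2l => //.
rewrite /gap_lyapunov.
by have := gap_prod_ge N (x + t); have := gap1_ge1 N (x + t); lra.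
Qed.

End kernels.

(** * The weak type estimate *)

Section weak_type.
Variable R : realType.
Implicit Types (x t : walsh_group) (l s : R).

Lemma mean_bool_le1 n (P : walsh_group -> bool) : mean n (fun x => (P x)%:R : R) <= 1.
Proof. by rewrite -[leRHS](mean_cst n); apply: ler_mean => x; rewrite lern1 leq_b1. Qed.

(** For [1 <= l], one value of the last coordinate resets [gap1] to [1] and contributes nothing; the
    other doubles it. Half of the bound at level [l / 2] is the bound at level [l]. *)
Lemma gap1_tail n l : 0 < l -> mean n (fun x => (l < gap1 R n x)%R%:R : R) <= l^-1.
Proof.
elim: n l => [|n IH] l l0; have [l1|l1] := ltP l 1.
- by apply: (le_trans (mean_bool_le1 _ _)); rewrite invf_ge1// ltW.
- by rewrite /mean /= invr_ge0 ltW.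
- by apply: (le_trans (mean_bool_le1 _ _)); rewrite invf_ge1// ltW.
rewrite meanS (_ : flip_avg _ _ = fun x => 2^-1 * (l / 2 < gap1 R n x)%R%:R).
  rewrite meanZ ler_pdivrMl// (le_trans (IH _ _)) ?divr_gt0//.
  by rewrite invf_div.
apply/funext => x; rewrite /flip_avg /= coordv_eq.
rewrite (cylinder_coordv _ (@cylinder_gap1 _ n))//.
rewrite ltr_pdivrMr// [gap1 _ _ _ * 2]mulrC.
by case: (x n); rewrite /= (ltNge l 1) l1 /= ?addr0 ?add0r mulrC.
Qed.

(** Writing the level as a square turns the quadrupling of [gap_prod] into [s / 2]. The correction
    [- s ^- 2] pays for the branch with [2 * gap1]: half of [2 / s^2 + 6 / s - 4 / s^2] is again
    [3 / s - 1 / s^2]. *)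
Lemma gap_prod_tail n s : 1 <= s ->
  mean n (fun x => (s ^+ 2 < gap_prod R n x)%R%:R : R) <= 3 / s - s ^- 2.
Proof.
elim: n s => [|n IH] s s1.
  rewrite /mean /= /gap_prod /= mulr1 ltNge exprn_ege1//=.
  rewrite -exprVn subr_ge0 expr2 ler_wpM2r ?invr_ge0//; first lra.
  by rewrite (@le_trans _ _ 1) ?invf_le1//; lra.
have s0 : 0 < s by lra.
have [s2|s2] := ltP s 2.
  apply: (le_trans (mean_bool_le1 _ _)); rewrite -exprVn.
  have : s^-1 <= 1 by rewrite invf_le1.
  have : 2^-1 <= s^-1 by rewrite lef_pV2 ?posrE// ltW.
  by move: s^-1 => r; nra.
rewrite meanS (_ : flip_avg _ _ = fun x =>
    2^-1 * ((s ^+ 2 / 2 < gap1 R n x)%R%:R + ((s / 2) ^+ 2 < gap_prod R n x)%R%:R)).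
  rewrite meanZ meanD.
  have H1 := @gap1_tail n (s ^+ 2 / 2) (divr_gt0 (exprn_gt0 _ s0) (ltr0n _ 2)).
  have s12 : 1 <= s / 2 by lra.
  have H2 := IH _ s12.
  rewrite ler_pdivrMl// (le_trans (lerD H1 H2))//.
  by rewrite !invf_div expr_div_n invf_div; lra.
apply/funext => x; rewrite /flip_avg !gap_prodS /= coordv_eq /gap_prod.
rewrite !(cylinder_coordv _ (@cylinder_gap1 _ n))//.
rewrite (cylinder_coordv _ (@cylinder_gap2 _ n))//.
rewrite ltr_pdivrMr// [gap1 _ _ _ * 2]mulrC expr_div_n.
have -> : (s ^+ 2 / 2 ^+ 2 < gap1 R n x * gap2 R n x) =
   (s ^+ 2 < 4 * (gap1 R n x * gap2 R n x)).
  by rewrite ltr_pdivrMr// [X in _ < X]mulrC -natrX.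
by case: (x n); rewrite /= mulrC // addrC.
Qed.

Lemma mean_min_gap_prod n s : 0 < s ->
  mean n (fun x => Num.min (gap_prod R n x) (s ^+ 2)) <= 12 * s.
Proof.
move=> s0.
(* Induction on the number of halvings of [s]; for [s <= 2] the truncation level [s ^+ 2] itself is
   at most [12 * s]. *)
suff H K : s <= 2 ^+ K.+1 -> mean n (fun x => Num.min (gap_prod R n x) (s ^+ 2)) <= 12 * s.
  apply: (H (Num.bound s)).
  rewrite (le_trans (ltW (archi_boundP (ltW s0))))// -natrX ler_nat.
  by rewrite ltnW// (leq_trans (ltn_expl _ (ltnSn 1)))// leq_exp2l.
have small r : 0 < r -> r <= 2 ->
    mean n (fun x => Num.min (gap_prod R n x) (r ^+ 2)) <= 12 * r.
  move=> r0 r2; apply: (@le_trans _ _ (r ^+ 2)); last nra.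
  by rewrite -[leRHS](mean_cst n); apply: ler_mean => x; rewrite ge_min lexx orbT.
elim: K s s0 => [|K IH] s s0 sK; first exact: small.
have [s2|s2] := leP s 2; first exact: small.
have {}IH := IH (s / 2) (divr_gt0 s0 (ltr0n _ 2)).
have {}IH : mean n (fun x => Num.min (gap_prod R n x) ((s / 2) ^+ 2)) <= 12 * (s / 2).
  by apply: IH; rewrite ler_pdivrMr// mulrC -exprS.
have s12 : 1 <= s / 2 by lra.
have T := gap_prod_tail n s12.
have -> : 12 * s = 12 * (s / 2) + s ^+ 2 * (3 / (s / 2)) by field; lra.
(* Raising the truncation level from [(s / 2) ^+ 2] to [s ^+ 2] costs at most [s ^+ 2] on the set
   where the lower level is exceeded, hence at most [6 * s] on average. *)
apply: (@le_trans _ _ (mean n (fun x => Num.min (gap_prod R n x) ((s / 2) ^+ 2)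
    + s ^+ 2 * ((s / 2) ^+ 2 < gap_prod R n x)%R%:R))).
  apply: ler_mean => x; have s20 : 0 <= (s / 2) ^+ 2 by rewrite sqr_ge0.
  have := sqr_ge0 s; rewrite /Num.min.
  case: ltP => a; case: ltP => b; case: ltP => c //=; lra.
rewrite meanD meanZ; apply: lerD => //; apply: ler_wpM2l; first exact: sqr_ge0.
by rewrite (le_trans T)// gerBl invr_ge0 sqr_ge0.
Qed.

Lemma mean_minZ_gap_prod n (v : R) s : 0 <= v -> 0 < s ->
  mean n (fun x => Num.min (v * gap_prod R n x) (s ^+ 2)) <= 12 * s * Num.sqrt v.
Proof.
rewrite le_eqVlt => /orP[/eqP<- s0|v0 s0].
  rewrite sqrtr0 mulr0 -[leRHS](mean_cst n); apply: ler_mean => x.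
  by rewrite mul0r ge_min lexx.
have r0 : 0 < Num.sqrt v by rewrite sqrtr_gt0.
have vr : v = Num.sqrt v ^+ 2 by rewrite sqr_sqrtr// ltW.
have -> : (fun x => Num.min (v * gap_prod R n x) (s ^+ 2)) =
    (fun x => v * Num.min (gap_prod R n x) ((s / Num.sqrt v) ^+ 2)).
  apply/funext => x; rewrite [RHS]minr_pMr ?(ltW v0)//; congr Num.min.
  by rewrite expr_div_n -vr mulrC divfK// gt_eqF.
rewrite meanZ.
have := mean_min_gap_prod n (divr_gt0 s0 r0); rewrite -(ler_pM2l v0).
move=> /le_trans; apply; rewrite le_eqVlt; apply/orP; left; apply/eqP.
by rewrite {1}vr; field; exact: lt0r_neq0.
Qed.

(** For a function of the first [n] coordinates, [2 ^+ n * mean n h] is the sum of its values;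
    truncation at [l] is subadditive on nonnegative numbers, as the induction shows pair by pair. *)
Lemma min_mean n (h : walsh_group -> R) l : (forall x, 0 <= h x) -> 0 <= l ->
  Num.min (2 ^+ n * mean n h) l <= 2 ^+ n * mean n (fun t => Num.min (h t) l).
Proof.
move=> h0 l0; elim: n h h0 => [|n IH] h h0; first by rewrite !mul1r.
have E (g : walsh_group -> R) : 2 ^+ n.+1 * mean n.+1 g =
    2 ^+ n * mean n (fun t => g t + g (t + coordv n)).
  rewrite meanS exprS [2 * _]mulrC -mulrA -meanZ; congr (_ * mean _ _).
  by apply/funext => t; rewrite /flip_avg; field.
rewrite !E (le_trans (IH _ _))//; first by move=> x; rewrite addr_ge0.
apply: ler_wpM2l; first by rewrite exprn_ge0.
apply: ler_mean => t; have := h0 t; have := h0 (t + coordv n).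
by rewrite /Num.min; case: ltP => ?; case: ltP => ?; case: ltP => ?; lra.
Qed.

Lemma min_sum (I : Type) (r : seq I) (F : I -> R) l : (forall i, 0 <= F i) -> 0 <= l ->
  Num.min (\sum_(i <- r) F i) l <= \sum_(i <- r) Num.min (F i) l.
Proof.
move=> F0 l0; elim: r => [|i r IH]; first by rewrite !big_nil ge_min lexx.
rewrite !big_cons; have := F0 i; have : 0 <= \sum_(i <- r) F i by exact: sumr_ge0.
by move: IH; rewrite /Num.min; case: ltP => ?; case: ltP => ?; case: ltP => ?; lra.
Qed.

(* Truncating every summand at the level [l] and using Markov's inequality
   makes the weak type estimates summable, since [1/2 < 1]. *)
Lemma weak_sum m (u : nat -> walsh_group -> R) (K l : R) :
  (forall n, cylinder n (u n)) -> (forall n x, 0 <= u n x) -> 0 <= K -> 0 < l ->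
  mean m (fun x => (l < \sum_(0 <= n < m)
    K / 2 ^+ n * mean n (fun t => u n t * gap_prod R n (x + t)))%R%:R) <=
  12 * Num.sqrt K / Num.sqrt l *
    \sum_(0 <= n < m) mean n (fun t => Num.sqrt (u n t)).
Proof.
move=> uc u0 K0 l0; pose s := Num.sqrt l.
have s0 : 0 < s by rewrite sqrtr_gt0.
have sl : s ^+ 2 = l by rewrite sqr_sqrtr// ltW.
(* The second division rewrites the mean as [2 ^+ n] times a mean, as [min_mean] requires. The
   square root of [v] then carries [2 ^- n], which cancels that factor. *)
pose v n t := K / 2 ^+ n / 2 ^+ n * u n t.
have v0 n t : 0 <= v n t by rewrite mulr_ge0// !divr_ge0// exprn_ge0.
have w0 n x : 0 <= gap_prod R n x by rewrite (le_trans ler01)// gap_prod_ge1.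
pose h n x := 2 ^+ n * mean n (fun t => v n t * gap_prod R n (x + t)).
have hE n x : K / 2 ^+ n * mean n (fun t => u n t * gap_prod R n (x + t)) = h n x.
  rewrite /h -!meanZ; congr mean; apply/funext => t; rewrite /v.
  by field; rewrite expf_neq0//.
have h0 n x : 0 <= h n x.
  by rewrite mulr_ge0 ?exprn_ge0// mean_ge0// => t; rewrite mulr_ge0.
under eq_fun do under eq_bigr do rewrite hE.
apply: (@le_trans _ _ (mean m (fun x => l^-1 * \sum_(0 <= n < m) Num.min (h n x) l))).
  apply: ler_mean => x; rewrite mulrC ler_pdivlMr//.
  apply: le_trans (min_sum _ _ (ltW l0)) => //.
  have : 0 <= \sum_(0 <= n < m) h n x by exact: sumr_ge0.
  by rewrite /Num.min; case: ltP => /= ?; case: ltP => /= ?; lra.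
rewrite meanZ mean_sum.
have -> : 12 * Num.sqrt K / Num.sqrt l = l^-1 * (12 * s * Num.sqrt K).
  by rewrite -/s -sl; field; exact: lt0r_neq0.
rewrite -[leRHS]mulrA ler_pM2l ?invr_gt0// mulr_sumr.
apply: ler_sum_nat => n /andP[_ nm].
apply: (@le_trans _ _ (mean m (fun x => 2 ^+ n * mean n (fun t =>
    Num.min (v n t * gap_prod R n (x + t)) l)))).
  by apply: ler_mean => x; apply: min_mean (ltW l0) => t; rewrite mulr_ge0.
rewrite meanZ mean_exchange -!meanZ; apply: ler_mean => t.
have cyl : cylinder n (fun x => Num.min (v n t * gap_prod R n x) l).
  exact: (cylinder_comp (fun w => Num.min (v n t * w) l) (@cylinder_gap_prod R n)).
have -> : mean m (fun x => Num.min (v n t * gap_prod R n (x + t)) l) =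
    mean n (fun x => Num.min (v n t * gap_prod R n x) (s ^+ 2)).
  rewrite (@mean_stable _ n m) ?(ltnW nm)//; last exact: cylinder_shiftr cyl.
  by rewrite (mean_shiftr t cyl) sl.
have := mean_minZ_gap_prod n (v0 n t) s0.
rewrite -(@ler_pM2l _ (2 ^+ n)) ?exprn_gt0// => /le_trans; apply.
rewrite le_eqVlt; apply/orP; left; apply/eqP.
rewrite /v sqrtrM; last by rewrite !divr_ge0// exprn_ge0.
have -> : K / 2 ^+ n / 2 ^+ n = K * (2 ^- n) ^+ 2 by field; rewrite expf_neq0.
rewrite sqrtrM// sqrtr_sqr ger0_norm ?invr_ge0 ?exprn_ge0//.
by field; rewrite expf_neq0.
Qed.

End weak_type.

(** * Partial sums of functions of finitely many coordinates *)

Section partial_sums.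
Variable R : realType.
Implicit Types (b u : walsh_group -> R).

Definition finite_sum m b k (x : walsh_group) : R :=
  \sum_(0 <= i < k) mean m (fun t => b t * kaczmarz R i t) * kaczmarz R i x.

Lemma finite_sumE m b k x :
  finite_sum m b k x = mean m (fun t => b t * kaczmarz_dirichlet R k (x + t)).
Proof.
rewrite /finite_sum /kaczmarz_dirichlet; under [X in _ = mean m X]eq_fun do rewrite mulr_sumr.
rewrite mean_sum; apply: eq_bigr => i _; rewrite mulrC -meanZ; congr mean.
by apply/funext => t; rewrite kaczmarz_add; ring.
Qed.

Lemma finite_sum_sum (I : Type) (r : seq I) m (b : I -> walsh_group -> R) k x :
  finite_sum m (fun t => \sum_(i <- r) b i t) k x =
  \sum_(i <- r) finite_sum m (b i) k x.
Proof.
rewrite finite_sumE; under eq_fun do rewrite mulr_suml.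
by rewrite mean_sum; apply: eq_bigr => i _; rewrite finite_sumE.
Qed.

(** The sum is a convolution with [block_kernel], at most [4 * gap_prod] at level [i]; passing from
    level [i] down to level [N] costs [3 * 2 ^+ (i - N)]. *)
Lemma finite_sum_block N i m l b u x : (N <= i)%N -> (i <= m)%N -> (l <= 2 ^ i)%N ->
  cylinder N u -> (forall t, `|b t| <= u t) ->
  `|\sum_(0 <= j < l) finite_sum m b (2 ^ i + j) x| <=
  12 * 2 ^+ (i - N) * mean N (fun t => u t * gap_prod R N (x + t)).
Proof.
move=> Ni im li uN bu.
have -> : \sum_(0 <= j < l) finite_sum m b (2 ^ i + j) x =
    mean m (fun t => b t * block_kernel R i l (x + t)).
  under eq_bigr do rewrite finite_sumE.
  rewrite -mean_sum; congr mean; apply/funext => t.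
  by rewrite -mulr_sumr.
rewrite (le_trans (ler_norm_mean _ _))//.
have u0 t : 0 <= u t by exact: le_trans (bu t).
apply: (@le_trans _ _ (4 * mean m (fun t => u t * gap_prod R i (x + t)))).
  rewrite -meanZ; apply: ler_mean => t; rewrite normrM mulrCA.
  by apply: ler_pM => //; exact: block_kernel_le.
rewrite (@mean_stable _ i m)//; last first.
  by apply: cylinder_op2; [exact: (cylinder_le Ni)|exact/cylinder_shift/cylinder_gap_prod].
have := mean_gap_prod x uN u0 Ni; lra.
Qed.

(** Nothing happens before index [2 ^ N]; from there on the block bounds form a geometric series in
    [2 ^+ (i - N)], summed by induction on [A]. *)
Lemma finite_sum_atom N m A n b u x : (A <= m)%N -> (n <= 2 ^ A)%N ->
  cylinder N u -> (forall t, `|b t| <= u t) ->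
  (forall k, (k < 2 ^ N)%N -> finite_sum m b k x = 0) ->
  `|\sum_(0 <= k < n) finite_sum m b k x| <=
  12 * 2 ^+ A / 2 ^+ N * mean N (fun t => u t * gap_prod R N (x + t)).
Proof.
move=> Am nA uN bu b0.
have u0 t : 0 <= u t by exact: le_trans (bu t).
have M0 : 0 <= mean N (fun t => u t * gap_prod R N (x + t)).
  by apply: mean_ge0 => t; rewrite mulr_ge0// (le_trans ler01)// gap_prod_ge1.
have small k : (k <= 2 ^ N)%N -> \sum_(0 <= j < k) finite_sum m b j x = 0.
  move=> kN; rewrite big_nat big1// => j /andP[_ jk].
  by apply: b0; exact: leq_trans kN.
elim: A n Am nA => [|A IH] n Am nA.
  rewrite small ?normr0; last by rewrite (leq_trans nA)// leq_exp2l.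
  by rewrite mulr_ge0// mulr_ge0 ?invr_ge0 ?exprn_ge0// mulr_ge0.
have mono : 12 * 2 ^+ A / 2 ^+ N * mean N (fun t => u t * gap_prod R N (x + t)) <=
  12 * 2 ^+ A.+1 / 2 ^+ N * mean N (fun t => u t * gap_prod R N (x + t)).
  apply: ler_wpM2r => //; rewrite ler_pM2r ?invr_gt0 ?exprn_gt0// ler_pM2l//.
  by rewrite exprS ler_peMl ?exprn_ge0// ler1n.
have [nA'|nA'] := leqP n (2 ^ A); first exact: le_trans (IH _ (ltnW Am) nA') mono.
have [AN|NA] := ltnP A N.
  rewrite small ?normr0; last by rewrite (leq_trans nA)// leq_exp2l.
  by apply: le_trans mono; rewrite mulr_ge0// mulr_ge0 ?invr_ge0 ?exprn_ge0// mulr_ge0// exprn_ge0.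
rewrite (big_cat_nat _ (ltnW nA'))//= -{2}[(2 ^ A)%N]add0n big_addn.
under [X in `|_ + X|]eq_bigr do rewrite addnC.
rewrite (le_trans (ler_normD _ _))//.
have l1 : (n - 2 ^ A <= 2 ^ A)%N by move: nA; rewrite expnS; lia.
have H1 := IH _ (ltnW Am) (leqnn _).
have H2 := finite_sum_block x NA (ltnW Am) l1 uN bu.
rewrite (le_trans (lerD H1 H2))// expfB_cond; last by rewrite pnatr_eq0.
rewrite exprS le_eqVlt; apply/orP; left; apply/eqP.
by field; rewrite expf_neq0.
Qed.

End partial_sums.

(** * Decomposition of martingales *)

Section decomposition.
Variable R : realType.
Variable f : nat -> walsh_group -> R.
Hypothesis f_cyl : forall n, cylinder n (f n).
Hypothesis f_avg : forall n, flip_avg n (f n.+1) = f n.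
Implicit Types x : walsh_group.

(** A predictable majorant: it is determined by the first [n] coordinates, yet dominates both [f n]
    and [f n.+1]. *)
Let c n x : R := Num.max `|f n.+1 x| `|f n.+1 (x + coordv n)|.

Let c_cyl n : cylinder n (c n).
Proof.
apply: (@cylinder_sym _ _ _ (fun a b : R => Num.max `|a| `|b|)) => // a b.
exact: maxC.
Qed.

Let c_ge n x : `|f n.+1 x| <= c n x.
Proof. by rewrite le_max lexx. Qed.

Let c_ge0 n x : 0 <= c n x.
Proof. exact: le_trans (c_ge n x). Qed.

Let c_ge_pred n x : `|f n x| <= c n x.
Proof.
rewrite -(f_avg n) /flip_avg normrM [`|2^-1|]ger0_norm// ler_pdivrMr//.
apply: le_trans (ler_normD _ _) _.
have : `|f n.+1 (x + coordv n)| <= c n x by rewrite le_max lexx orbT.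
by have := c_ge n x; lra.
Qed.

(* The times at which [c] more than doubles are the starting times of the
   pieces of the decomposition; [start n x] is the last of them before [n]. *)
Let Fixpoint start (n : nat) x : nat :=
  if n is m.+1 then
    if 2 * c (start m x) x < c m.+1 x then m.+1 else start m x
  else 0.

Let start_le n x : (start n x <= n)%N.
Proof. by elim: n => //= n IH; case: ifP => // _; exact: leqW. Qed.

Let start_idem n x : start (start n x) x = start n x.
Proof.
elim: n => //= n IH; case E : (2 * _ < _) => //=.
by rewrite E.
Qed.

Let start_dyadic n x y : dyadic_interval n x y -> start n y = start n x.
Proof.
elim: n => //= n IH xy.
have {}IH : start n y = start n x by apply: IH => i ni; apply: xy; exact: ltnW.
rewrite IH (c_cyl xy) (@cylinder_le _ _ n.+1 _ _ (@c_cyl (start n x)) x y)//.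
exact: leqW (start_le _ _).
Qed.

Let c_start n x : c n x <= 2 * c (start n x) x.
Proof.
case: n => [|n] /=; first by have := c_ge0 0%N x; lra.
by case: ltP => // _; have := c_ge0 n.+1 x; lra.
Qed.

(** The size of the piece that starts at time [n]; it vanishes where no piece starts at that
    time. *)
Let u n x : R := if start n x == n then c n x else 0.

Let u_ge0 n x : 0 <= u n x.
Proof. by rewrite /u; case: ifP. Qed.

Let u_cyl n : cylinder n (u n).
Proof. by move=> x y xy; rewrite /u (start_dyadic xy) (c_cyl xy). Qed.

(** The piece starting at time [n], stopped at time [m]: it collects the increments made while [n]
    is the last starting time. The initial value [f 0] belongs to piece [0]. *)
Let b m n x : R := \sum_(0 <= j < m) (start j x == n)%:R * (f j.+1 x - f j x)
   + (n == 0%N)%:R * f 0%N x.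

Let bS m n x : b m.+1 n x = b m n x + (start m x == n)%:R * (f m.+1 x - f m x).
Proof. by rewrite /b big_nat_recr//= addrAC. Qed.

Let b_zero m n x : (start m x < n)%N -> b m.+1 n x = 0.
Proof.
elim: m => [|m IH] mn; first by rewrite /b big_nat1/= (ltn_eqF mn) (gtn_eqF mn) !mul0r addr0.
rewrite bS IH; last first.
  apply: leq_ltn_trans mn => /=; case: ifP => // _.
  by rewrite leqW// start_le.
by rewrite ltn_eqF// mul0r addr0.
Qed.

Let b_start m x : b m.+1 (start m x) x =
  f m.+1 x - (start m x != 0%N)%:R * f (start m x) x.
Proof.
elim: m => [|m IH].
  by rewrite /b big_nat1/=; ring.
rewrite bS eqxx /=; case: ifP => [_|/= _]; last by rewrite IH; ring.
by rewrite b_zero ?ltnS ?start_le//=; ring.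
Qed.

(** An active piece telescopes to a difference of two values of [f]: the current one is at most
    [2 * c] and the initial one at most [c], with [c] taken at the start. Afterwards the piece is
    frozen. *)
Let b_bound m n x : `|b m.+1 n x| <= 3 * u n x.
Proof.
have key k : `|b k.+1 (start k x) x| <= 3 * u (start k x) x.
  rewrite b_start (le_trans (ler_normB _ _))// /u start_idem eqxx normrM.
  have : `|(start k x != 0%N)%:R : R| * `|f (start k x) x| <= c (start k x) x.
    apply: le_trans (c_ge_pred _ _); rewrite normr_nat ler_piMl//.
    by case: (_ == _) => /=.
  by have := c_ge k x; have := c_start k x; lra.
elim: m => [|m IH].
  case: n => [|n]; first exact: (key 0%N).
  by rewrite b_zero// normr0 mulr_ge0.
have [<-|ne] := eqVneq (start m.+1 x) n; first exact: key.
by rewrite bS (negbTE ne) mul0r addr0.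
Qed.

Let b_sum m x : (0 < m)%N -> f m x = \sum_(0 <= n < m) b m n x.
Proof.
move=> m0; rewrite /b big_split/= exchange_big/=.
have -> : \sum_(0 <= n < m) (n == 0%N)%:R * f 0%N x = f 0%N x.
  rewrite big_ltn//= mul1r big_nat big1 ?addr0// => -[|n]//= _.
  by rewrite mul0r.
rewrite (@eq_big_nat _ _ _ _ _ _ (fun j => f j.+1 x - f j x)).
  by rewrite telescope_sumr// subrK.
move=> j /andP[_ jm]; rewrite -mulr_suml (bigD1_seq (start j x)) ?iota_uniq//=.
  by rewrite eqxx big1 ?addr0 ?mul1r// => i; rewrite eq_sym => /negbTE->.
by rewrite mem_index_iota/= (leq_ltn_trans (start_le _ _)).
Qed.

(** Increments before time [n] do not enter the piece. At a later time [j], both the indicator of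
    [start j x = n] and [kaczmarz R i] are known, so the increment is orthogonal to their
    product. *)
Let b_coef m n i : (0 < n)%N -> (i < 2 ^ n)%N ->
  mean m (fun t => b m n t * kaczmarz R i t) = 0.
Proof.
move=> n0 ni; rewrite /b (gtn_eqF n0).
under eq_fun do rewrite mul0r addr0 mulr_suml.
rewrite mean_sum big_nat big1// => j /andP[_ jm].
have [jn|nj] := ltnP j n.
  rewrite -[RHS](mean_cst m); congr mean; apply/funext => t.
  by rewrite ltn_eqF ?mul0r// (leq_ltn_trans (start_le _ _)).
have -> : (fun x => (start j x == n)%:R * (f j.+1 x - f j x) * kaczmarz R i x) =
  (fun x => ((start j x == n)%:R * kaczmarz R i x) * (f j.+1 x - f j x)).
  by apply/funext => x; ring.
apply: (mean_odd jm).
- move=> x y xy; rewrite (start_dyadic xy) (cylinder_kaczmarz R _ xy)//.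
  by rewrite (leq_trans ni)// leq_exp2l.
- move=> x y xy; rewrite (f_cyl xy).
  by rewrite (cylinder_le (leqnSn j) (@f_cyl j) xy).
move=> x; rewrite /flip_avg (cylinder_coordv _ (@f_cyl j))//.
by rewrite -(f_avg j) /flip_avg; field.
Qed.

Fixpoint running_max m x : R :=
  if m is k.+1 then Num.max (running_max k x) `|f k.+1 x| else `|f 0%N x|.

Lemma running_maxS m x :
  running_max m.+1 x = Num.max (running_max m x) `|f m.+1 x|.
Proof. by []. Qed.

Lemma running_max_ge0 m x : 0 <= running_max m x.
Proof. by elim: m => //= m IH; rewrite le_max IH. Qed.

Lemma cylinder_running_max m : cylinder m (running_max m).
Proof.
elim: m => [|m IH] x y xy; first by rewrite /= (f_cyl xy).
by rewrite !running_maxS (cylinder_le (leqnSn m) IH xy) (f_cyl xy).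
Qed.

(** At least one of [x] and [x + coordv n] attains the maximum [c n]. Keeping only such points
    ensures [c n x <= running_max n.+1 x], and costs a factor [2] in the mean. *)
Let y n x : R := ((start n x == n) && (`|f n.+1 x| == c n x))%:R * Num.sqrt (c n x).

(* The nonzero terms of the sum have geometrically increasing values of [c]. *)
Let y_sum m x : \sum_(0 <= n < m.+1) y n x <=
  4 * Num.sqrt (Num.min (c (start m x) x) (running_max m.+1 x)).
Proof.
have c0 n := c_ge0 n x.
elim: m => [|m IH].
  rewrite big_nat1 /y; case: andP => [[_ /eqP E]|_]; last first.
    by rewrite mul0r mulr_ge0// sqrtr_ge0.
  rewrite [start 0 x]/=.
  rewrite mul1r.
  have -> : Num.min (c 0%N x) (running_max 1 x) = c 0%N x.
    by apply/min_idPl; rewrite running_maxS le_max -E; apply/orP; right.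
  by have := sqrtr_ge0 (c 0%N x); lra.
rewrite big_nat_recr//=.
have mono : Num.sqrt (Num.min (c (start m x) x) (running_max m.+1 x)) <=
    Num.sqrt (Num.min (c (start m.+1 x) x) (running_max m.+2 x)).
  apply: ler_wsqrtr.
  have RM : running_max m.+1 x <= running_max m.+2 x by rewrite (running_maxS m.+1) le_max lexx.
  have CM : c (start m x) x <= c (start m.+1 x) x.
    by move=> /=; case: ifP => // ctop; have := c0 (start m x); lra.
  by rewrite le_min !ge_min CM RM orbT.
rewrite {2}/y; case: andP => [[/eqP s E]|_] /=; last first.
  by rewrite mul0r addr0 (le_trans IH)// ler_pM2l.
rewrite mul1r.
have cm : 2 * c (start m x) x < c m.+1 x.
  by move: s => /=; case: ifP => // _ s; have := start_le m x; rewrite s ltnn.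
have -> : Num.min (c (start m.+1 x) x) (running_max m.+2 x) = c m.+1 x.
  by rewrite s; apply/min_idPl; rewrite running_maxS le_max -(eqP E); apply/orP; right.
have {}IH : \sum_(0 <= i < m.+1) y i x <= 4 * Num.sqrt (c (start m x) x).
  by rewrite (le_trans IH)// ler_pM2l// ler_wsqrtr// ge_min lexx.
(* At a new start [c] has more than doubled, and the square root of [1/2] is below [3/4]; hence the
   constant [4] is stable, as [4 * (3/4) + 1 = 4]. *)
suff : Num.sqrt (c (start m x) x) <= 3 / 4 * Num.sqrt (c m.+1 x) by lra.
rewrite -(@ler_sqr R) ?nnegrE ?mulr_ge0 ?sqrtr_ge0 ?divr_ge0//.
rewrite exprMn !sqr_sqrtr//.
by have := c0 m.+1; have := c0 (start m x); lra.
Qed.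

Let u_sum m :
  \sum_(0 <= n < m) mean n (fun t => Num.sqrt (u n t)) <=
  8 * mean m (fun t => Num.sqrt (running_max m t)).
Proof.
apply: (@le_trans _ _ (\sum_(0 <= n < m) 2 * mean m (y n))).
  apply: ler_sum_nat => n /andP[_ nm].
  have ucyl : cylinder n (fun t => Num.sqrt (u n t)).
    exact: (cylinder_comp (@Num.sqrt R) (@u_cyl n)).
  rewrite -(mean_stable ucyl (ltnW nm)).
  have ycyl : cylinder m (y n).
    move=> t s ts; rewrite /y (start_dyadic (x := t)); last first.
      by move=> i ij; apply: ts; exact: ltn_trans nm.
    by rewrite (cylinder_le nm (@f_cyl n.+1) ts) (cylinder_le (ltnW nm) (@c_cyl n) ts).
  rewrite -(mean_flip_avg nm ycyl) -meanZ; apply: ler_mean => t.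
  rewrite /flip_avg [2 * _]mulrC divfK// /y /u.
  rewrite (start_dyadic (dyadic_coordv t (leqnn n))) (cylinder_coordv _ (@c_cyl n))//.
  case: eqP => /= _; last by rewrite sqrtr0 !mul0r addr0.
  have s0 := sqrtr_ge0 (c n t).
  have [E|E] := eqVneq `|f n.+1 t| (c n t); first by rewrite mul1r lerDl mulr_ge0.
  rewrite mul0r add0r.
  suff -> : `|f n.+1 (t + coordv n)| == c n t by rewrite mul1r.
  move: E; rewrite /c; case: ltP => [_ _|_]; rewrite eqxx//.
rewrite -mulr_sumr -mean_sum.
suff : mean m (fun x => \sum_(0 <= n < m) y n x) <=
  mean m (fun x => 4 * Num.sqrt (running_max m x)) by rewrite meanZ; lra.
apply: ler_mean => x; case: m => [|m].
  by rewrite big_geq// mulr_ge0// sqrtr_ge0.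
apply: (le_trans (y_sum m x)); rewrite ler_pM2l//; apply: ler_wsqrtr.
by rewrite ge_min lexx orbT.
Qed.

(** A finite atomic decomposition without normalisation: the sizes [u n] are functions rather than
    constants, and the sum of the means of their square roots replaces the usual sum of
    coefficients. *)
Lemma martingale_decomposition m : (0 < m)%N ->
  exists b u : nat -> walsh_group -> R,
  [/\ forall n, cylinder n (u n) /\ forall x, 0 <= u n x,
      forall n x, `|b n x| <= 3 * u n x,
      forall x, f m x = \sum_(0 <= n < m) b n x,
      forall n i, (0 < n)%N -> (i < 2 ^ n)%N ->
        mean m (fun t => b n t * kaczmarz R i t) = 0 &
      \sum_(0 <= n < m) mean n (fun t => Num.sqrt (u n t)) <=
      8 * mean m (fun t => Num.sqrt (running_max m t))].
Proof.
move=> m0; exists (b m), u; split => //.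
- by case: m m0.
- by move=> x; exact: b_sum.
- by move=> n i; exact: b_coef.
Qed.

(** One function [G] serves all orders [n] at once, so the weak type bound for [G] controls a
    maximal operator. It is the sum over the pieces of the bounds from [finite_sum_atom]. *)
Lemma fejer_domination m : exists G : walsh_group -> R,
  [/\ forall x, 0 <= G x,
      forall n x, (n < 2 ^ m)%N ->
        `|\sum_(0 <= k < n.+1) finite_sum m (f m) k x| <= n%:R * G x &
      forall l, 0 < l -> mean m (fun x => (l < G x)%R%:R) <=
        1000 / Num.sqrt l * mean m (fun t => Num.sqrt (running_max m t))].
Proof.
have [m0|m0] := posnP m.
  exists (fun=> 0); split => //.
  - move=> n x; rewrite m0 ltnS leqn0 => /eqP->.
    by rewrite big_nat1 /finite_sum big_geq// normr0 mul0r.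
  - move=> l l0; rewrite ltNge (ltW l0)/= mean_cst.
    apply: mulr_ge0; first exact: divr_ge0 (ler0n _ _) (sqrtr_ge0 _).
    by apply: mean_ge0 => x; exact: sqrtr_ge0.
have [b' [u' [u'P b'u fE b'0 u'sum]]] := martingale_decomposition m0.
pose g n x := mean n (fun t => u' n t * gap_prod R n (x + t)).
have g0 n x : 0 <= g n x.
  apply: mean_ge0 => t; rewrite mulr_ge0 ?(u'P n).2//.
  by rewrite (le_trans ler01)// gap_prod_ge1.
(* The constant is [12 * 3 * 2]: [12] from [finite_sum_atom], [3] from the bound on the pieces, [2]
   from replacing [2 ^ A.+1] by [n]. *)
exists (fun x => \sum_(0 <= n < m) 72 / 2 ^+ n * g n x); split.
- move=> x; apply: sumr_ge0 => n _.
  by rewrite mulr_ge0 ?divr_ge0 ?exprn_ge0.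
- move=> n x nm; have [->|n0] := posnP n.
    by rewrite big_nat1 /finite_sum big_geq// normr0 mul0r.
  have -> : \sum_(0 <= k < n.+1) finite_sum m (f m) k x =
      \sum_(0 <= N < m) \sum_(0 <= k < n.+1) finite_sum m (b' N) k x.
    rewrite exchange_big/=; apply: eq_bigr => k _; rewrite -finite_sum_sum.
    by congr finite_sum; apply/funext => t; exact: fE.
  rewrite (le_trans (ler_norm_sum _ _ _))// mulr_sumr.
  apply: ler_sum_nat => N /andP[_ Nm].
  have [A [j [jA nE]]] := nat_block n0.
  have Am : (A.+1 <= m)%N.
    by rewrite -(ltn_exp2l _ _ (ltnSn 1)) (leq_ltn_trans _ nm)// nE leq_addr.
  have nA : (n.+1 <= 2 ^ A.+1)%N by rewrite expnS; lia.
  have u3 : cylinder N (fun t => 3 * u' N t).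
    exact: (cylinder_comp (fun a => 3 * a) (u'P N).1).
  have := @finite_sum_atom R N m A.+1 n.+1 (b' N) _ x Am nA u3 (b'u N).
  have -> : mean N (fun t => 3 * u' N t * gap_prod R N (x + t)) = 3 * g N x.
    by rewrite -meanZ; congr mean; apply/funext => t; ring.
  move=> H; apply: (le_trans (H _)) => {H}; last first.
    rewrite exprS.
    have -> : 12 * (2 * 2 ^+ A) / 2 ^+ N * (3 * g N x) =
      2 ^+ A * (72 / 2 ^+ N * g N x) by ring.
    apply: ler_wpM2r; first by rewrite mulr_ge0 ?divr_ge0 ?exprn_ge0.
    by rewrite nE -natrX ler_nat leq_addr.
  move=> k kN; rewrite /finite_sum big_nat big1// => i /andP[_ ik].
  (* Piece [0] has no vanishing coefficients, but then [k < 1] leaves an empty sum. *)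
  have [N0|N0] := posnP N; first by move: kN ik; rewrite N0 expn0 ltnS leqn0 => /eqP->.
  by rewrite b'0 ?mul0r// (ltn_trans ik).
- move=> l l0.
  have := @weak_sum R m u' 72 l (fun n => (u'P n).1) (fun n => (u'P n).2) (ler0n _ _) l0.
  move=> /le_trans; apply.
  (* Together with the factors [12] and [8] this gives [960], below the announced [1000]. *)
  have s72 : Num.sqrt 72 <= 10 :> R.
    rewrite -(@ler_sqr R) ?nnegrE ?sqrtr_ge0// sqr_sqrtr//; lra.
  set M := mean m _ in u'sum *.
  have M0 : 0 <= M by apply: mean_ge0 => x; exact: sqrtr_ge0.
  have := sqrtr_ge0 (72 : R); rewrite -sqrtr_gt0 in l0.
  move=> s0; apply: (@le_trans _ _ (12 * Num.sqrt 72 / Num.sqrt l * (8 * M))).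
    by apply: ler_wpM2l => //; rewrite mulr_ge0 ?invr_ge0 ?mulr_ge0// ltW.
  have -> : 12 * Num.sqrt 72 / Num.sqrt l * (8 * M) =
    (96 * Num.sqrt 72) * (M / Num.sqrt l) by ring.
  have -> : 1000 / Num.sqrt l * M = 1000 * (M / Num.sqrt l) by ring.
  apply: ler_wpM2r; first by rewrite divr_ge0// ltW.
  by lra.
Qed.

End decomposition.

(** * Integration against the Haar measure *)

Lemma filtration_cylinder n (A : set walsh_group) :
  dyadic_filtration n A -> cylinder n A.
Proof.
move: A; apply: smallest_sub; last first.
  move=> _ [z _ <-] x y xy; apply/propext; split => h i ni; first by rewrite -xy// h.
  by rewrite xy// h.
split => //.
  move=> A cA x y xy; apply/propext; rewrite /= /setD /= (cA _ _ xy).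
  by split=> -[].
move=> A cA x y xy; apply/propext; split => -[k _ Ak]; exists k => //.
  by rewrite -(cA k x y xy).
by rewrite (cA k x y xy).
Qed.

(** Such a set is a finite union of dyadic intervals, indexed by the words of length [n], here
    padded with [false]. *)
Lemma cylinder_filtration n (A : set walsh_group) :
  cylinder n A -> dyadic_filtration n A.
Proof.
move=> cA.
pose pt (c : {ffun 'I_n -> bool}) : walsh_group :=
  fun i => if insub i is Some j then c j else false.
have -> : A = \bigcup_(c in [set c | A (pt c)]) dyadic_interval n (pt c).
  apply/seteqP; split => [x Ax|x [c /= Ac cx]]; last by rewrite (cA _ _ cx).
  exists [ffun j : 'I_n => x j]; last first.
    by move=> i ni; rewrite /pt insubT ffunE.
  rewrite /= (cA x)// => i ni; by rewrite /pt insubT ffunE.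
apply: (@fin_bigcup_measurable _ (g_sigma_algebraType (dyadic_intervals n))).
  exact: finite_finset.
by move=> c _; apply: sub_sigma_algebra; exists (pt c).
Qed.

Lemma cylinder_measurable n (A : set walsh_group) : cylinder n A -> measurable A.
Proof.
move/cylinder_filtration; apply: sub_sigma_algebra2 => B dB; by exists n.
Qed.

Section haar_integral.
Variables (R : realType) (mu : probability walsh_group R).
Hypothesis mu_haar : is_haar mu.
Implicit Types g h : walsh_group -> R.

Lemma cylinder_measurable_fun n g : cylinder n g -> measurable_fun setT g.
Proof.
move=> gn _ B _; rewrite setTI; apply: (@cylinder_measurable n) => x y xy.
by apply/propext; rewrite /= (gn x y xy).
Qed.

Lemma cylinder_bounded n g : cylinder n g -> exists M, forall x, `|g x| <= M.
Proof.
move=> gn; exists (2 ^+ n * mean n (fun x => `|g x|)) => x.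
by apply: (@ler_mean_pt R n (fun x => `|g x|)) => //; exact: (cylinder_comp (fun a : R => `|a|) gn).
Qed.

Lemma cylinder_integrable n g : cylinder n g -> mu.-integrable setT (EFin \o g).
Proof.
move=> gn; apply: measurable_bounded_integrable => //.
- by rewrite (le_lt_trans (probability_le1 mu _)) ?ltry.
- exact: cylinder_measurable_fun gn.
have [M gM] := cylinder_bounded gn.
exists M; split; first exact: num_real.
by move=> r Mr x _ /=; rewrite (le_trans (gM x))// ltW.
Qed.

Lemma shift_measurable (a : walsh_group) :
  measurable_fun [set: walsh_group] (fun y : walsh_group => a + y).
Proof.
apply: (@measurability _ _ _ walsh_group setT _ (\bigcup_n dyadic_intervals n)) => //.
move=> _ [_ [n _ [x _ <-]] <-]; rewrite setTI; apply: (@cylinder_measurable n).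
apply: (@cylinder_shift _ n a (dyadic_interval n x : walsh_group -> Prop)).
by apply: filtration_cylinder; apply: sub_sigma_algebra; exists x.
Qed.

Lemma integral_shift (a : walsh_group) n g : cylinder n g ->
  (\int[mu]_x (g (a + x))%:E = \int[mu]_x (g x)%:E)%E.
Proof.
move=> gn; pose phi (y : walsh_group) : walsh_group := a + y.
have mg : measurable_fun [set: walsh_group] (fun x => (g x)%:E).
  by apply/measurable_EFinP; exact: cylinder_measurable_fun gn.
have H := @integral_pushforward _ _ _ _ R _ (shift_measurable a) mu setT _ mg.
rewrite preimage_setT in H.
rewrite -[LHS]H//; last first.
  by apply: (@cylinder_integrable n (g \o phi)); exact: cylinder_shift.
apply: eq_measure_integral; first exact: shift_measurable.
move=> ? A mA _; transitivity (mu [set a + x | x in A]); last exact: mu_haar.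
rewrite /pushforward; congr (mu _); apply/seteqP; split => [y Ay|_ [y Ay <-]] /=.
  by exists (a + y) => //; exact: walsh_addK.
by rewrite walsh_addK.
Qed.

(** Invariance under translation by [coordv n] allows [g] to be replaced by [flip_avg n g], which
    depends on one coordinate less. *)
Lemma integral_cylinder n g : cylinder n g ->
  (\int[mu]_x (g x)%:E = (mean n g)%:E)%E.
Proof.
elim: n g => [|n IH] g gn.
  rewrite (_ : g = fun=> g 0); last by apply/funext => x; apply: (gn 0 x).
  rewrite integral_cst// -[RHS]mule1; congr (_ * _)%E.
  exact: probability_setT.
rewrite meanS -IH; last exact: cylinder_flip_avg.
have gS : cylinder n.+1 (fun x => g (x + coordv n)) by exact: cylinder_shiftr.
have E x : (flip_avg n g x)%:E = (2^-1%:E * ((g x)%:E + (g (x + coordv n))%:E))%E.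
  by rewrite -EFinD -EFinM /flip_avg mulrC.
under [RHS]eq_integral do rewrite E.
rewrite integralZl//; last first.
  by apply: integrableD => //; [exact: (cylinder_integrable gn)|exact: (cylinder_integrable gS)].
rewrite integralD//; [|exact: (cylinder_integrable gn)|exact: (cylinder_integrable gS)].
have -> : (\int[mu]_x (g (x + coordv n))%:E = \int[mu]_x (g x)%:E)%E.
  by rewrite -(integral_shift (coordv n) gn); apply: eq_integral => x _; rewrite addrC.
have fin : (\int[mu]_x (g x)%:E)%E \is a fin_num.
  by apply: integrable_fin_num => //; exact: (cylinder_integrable gn).
by rewrite -(fineK fin) -EFinD -EFinM; congr EFin; field.
Qed.

Lemma Rintegral_cylinder n g : cylinder n g -> \int[mu]_x g x = mean n g.
Proof. by move=> gn; rewrite /Rintegral (integral_cylinder gn). Qed.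

Lemma measure_cylinder n (P : walsh_group -> bool) : cylinder n P ->
  mu [set x | P x] = (mean n (fun x => (P x)%:R))%:E.
Proof.
move=> Pn; rewrite -(@integral_cylinder n); last first.
  exact: (cylinder_comp (fun b : bool => b%:R) Pn).
have mP : measurable [set x | P x].
  by apply: (@cylinder_measurable n) => x y xy; apply/propext; rewrite /= (Pn x y xy).
have := integral_cst mu mP 1; rewrite mul1e => <-.
rewrite integral_mkcond; apply: eq_integral => x _.
by rewrite patchE mem_setE unfold_in; case: (P x).
Qed.

Lemma integral_cylinder_set n (P : walsh_group -> bool) g :
  cylinder n P -> cylinder n g ->
  (\int[mu]_(x in [set x | P x]) (g x)%:E = (mean n (fun x => (P x)%:R * g x))%:E)%E.
Proof.
move=> Pn gn; rewrite -(@integral_cylinder n); last first.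
  by apply: cylinder_op2 gn; exact: (cylinder_comp (fun b : bool => b%:R) Pn).
rewrite integral_mkcond; apply: eq_integral => x _.
by rewrite patchE mem_setE unfold_in; case: (P x); rewrite ?mul1r ?mul0r.
Qed.

Lemma cylinder_martingale (f : nat -> walsh_group -> R) :
  (forall n, cylinder n (f n)) -> (forall n, flip_avg n (f n.+1) = f n) ->
  is_martingale mu f.
Proof.
move=> fc fa; split.
- by move=> n; exact: cylinder_integrable (fc n).
- move=> n B _; apply: cylinder_filtration => x y xy.
  by apply/propext; rewrite /= (fc n x y xy).
move=> m n mn A /filtration_cylinder Am.
have -> : A = [set x | x \in A] by apply/seteqP; split => x; rewrite /= in_setE.
have Pm : cylinder m (fun x => x \in A).
  by move=> x y xy; apply/idP/idP; rewrite !in_setE (Am x y xy).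
rewrite (integral_cylinder_set Pm (fc m)).
rewrite (integral_cylinder_set (cylinder_le mn Pm) (fc n)).
congr EFin; rewrite -(subnK mn); elim: (n - m)%N => // d <-.
have PR : cylinder (d + m) (fun x => (x \in A)%:R : R).
  by apply: (cylinder_comp (fun b : bool => b%:R)); exact: (cylinder_le (leq_addl d m)).
by rewrite addSn meanS (@flip_avgM _ _ _ _ (f (d + m).+1) PR (leqnn _)) fa.
Qed.

(** * Martingales as sequences of cylinder functions, and their Kaczmarz coefficients *)

Section martingale.
Variable f : nat -> walsh_group -> R.
Hypothesis mf : is_martingale mu f.

Lemma martingale_cylinder n : cylinder n (f n).
Proof.
case: mf => _ fm _ x y xy.
have := filtration_cylinder (fm n [set f n x] (measurable_set1 _)) xy.
by move=> E; have : (f n @^-1` [set f n x]) x by []; rewrite -E.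
Qed.

(** The difference [h] of the two sides has zero integral over every set in [F_n], in particular
    where [h >= 0] and where [h < 0]. So [|h|] has mean zero, and [ler_mean_pt] makes [h] vanish at
    every point. *)
Lemma martingale_avg n : flip_avg n (f n.+1) = f n.
Proof.
have fc := martingale_cylinder.
pose h x := flip_avg n (f n.+1) x - f n x.
have hc : cylinder n h.
  exact: (cylinder_op2 (fun a b => a - b) (cylinder_flip_avg (fc n.+1)) (fc n)).
have key (P : walsh_group -> bool) : cylinder n P ->
    mean n (fun x => (P x)%:R * h x) = 0.
  move=> Pn; have cA : cylinder n [set x | P x].
    by move=> x y xy; apply/propext; rewrite /= (Pn x y xy).
  case: mf => _ _ /(_ n n.+1 (leqnSn n) _ (cylinder_filtration cA)) E.
  have PR : cylinder n (fun x => (P x)%:R : R).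
    exact: (cylinder_comp (fun b : bool => b%:R) Pn).
  rewrite (integral_cylinder_set (cylinder_le (leqnSn n) Pn) (fc n.+1)) in E.
  rewrite (integral_cylinder_set Pn (fc n)) in E.
  have {}E := EFin_inj E.
  rewrite meanS (flip_avgM _ PR)// in E.
  have -> : (fun x => (P x)%:R * h x) =
      (fun x => (P x)%:R * flip_avg n (f n.+1) x + (-1) * ((P x)%:R * f n x)).
    by apply/funext => x; rewrite /h; ring.
  by rewrite meanD meanZ E; ring.
have sq : mean n (fun x => `|h x|) = 0.
  have -> : (fun x => `|h x|) = (fun x => (0 <= h x)%R%:R * h x
      + (-1) * ((h x < 0)%R%:R * h x)).
    by apply/funext => x; case: ltrgt0P; rewrite /=; lra.
  rewrite meanD meanZ !key ?mulr0 ?addr0//.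
    exact: (cylinder_comp (fun a => a < 0) hc).
  exact: (cylinder_comp (fun a => 0 <= a) hc).
apply/funext => x; apply/eqP; rewrite -subr_eq0 -normr_le0.
have -> : 0 = 2 ^+ n * mean n (fun x => `|h x|) by rewrite sq mulr0.
by apply: (@ler_mean_pt R n (fun x => `|h x|)) => //; exact: (cylinder_comp (fun a : R => `|a|) hc).
Qed.

(** The integrals defining the coefficient are constant from time [m] on, since later increments are
    orthogonal to [kaczmarz R i]. *)
Lemma kaczmarz_coefE m i : (i < 2 ^ m)%N ->
  kaczmarz_coef mu f i = mean m (fun t => f m t * kaczmarz R i t).
Proof.
move=> im; rewrite /kaczmarz_coef.
have fc := martingale_cylinder.
have E n : (m <= n)%N ->
    \int[mu]_x (f n x * kaczmarz R i x) = mean m (fun t => f m t * kaczmarz R i t).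
  have kc N : (m <= N)%N -> cylinder N (kaczmarz R i).
    by move=> mN; apply: cylinder_kaczmarz; rewrite (leq_trans im)// leq_exp2l.
  move=> mn; rewrite (@Rintegral_cylinder n); last exact: cylinder_op2 (fc n) (kc n mn).
  rewrite -(subnK mn); elim: (n - m)%N => // d <-.
  rewrite addSn meanS (_ : (fun x => _) = fun x => kaczmarz R i x * f (d + m).+1 x).
    rewrite (@flip_avgM _ _ _ _ (f (d + m).+1) (kc _ (leq_addl d m)) (leqnn _)) martingale_avg.
    by congr mean; apply/funext => x; rewrite mulrC.
  by apply/funext => x; rewrite mulrC.
apply/(@cvg_lim R) => //; apply: cvg_near_cst.
by exists m => // n /= mn; exact: E.
Qed.

Lemma kaczmarz_sumE m k x : (k <= 2 ^ m)%N ->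
  kaczmarz_sum mu k f x = finite_sum m (f m) k x.
Proof.
move=> km; rewrite /kaczmarz_sum /finite_sum; apply: eq_big_nat => i /andP[_ ik].
by rewrite (@kaczmarz_coefE m)// (leq_trans ik).
Qed.

Lemma martingale_max_measurable : measurable_fun setT (martingale_max f).
Proof.
rewrite (_ : martingale_max f = fun x => esups (fun n => `|f n x|%:E) 0%N).
  apply: measurable_fun_esups => n; apply/measurable_EFinP.
  apply: measurableT_comp => //; exact: (cylinder_measurable_fun (martingale_cylinder (n := n))).
apply/funext => x; rewrite /martingale_max /esups /= /sdrop; congr ereal_sup.
by apply/seteqP; split => _ [n _ <-]; exists n.
Qed.

Lemma martingale_max_ge m x : ((running_max f m x)%:E <= martingale_max f x)%E.
Proof.
elim: m => [|m IH]; first by apply: ereal_sup_ubound; exists 0%N.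
rewrite running_maxS EFin_max ge_max IH /=.
by apply: ereal_sup_ubound; exists m.+1.
Qed.

Lemma mean_running_max_le (p : R) m : 0 <= p ->
  ((mean m (fun t => running_max f m t `^ p))%:E <=
   \int[mu]_x (`|martingale_max f x| `^ p))%E.
Proof.
move=> p0; have rc : cylinder m (fun t => running_max f m t `^ p).
  exact: (cylinder_comp (fun a => a `^ p) (cylinder_running_max martingale_cylinder (m := m))).
rewrite -(integral_cylinder rc); apply: ge0_le_integral => //.
- by move=> x _; rewrite lee_fin powR_ge0.
- by apply/measurable_EFinP; exact: cylinder_measurable_fun rc.
- apply: (measurableT_comp (measurable_poweR _)).
  by apply: measurableT_comp => //; exact: martingale_max_measurable.
move=> x _; have m0 := running_max_ge0 f m x.
rewrite -poweR_EFin; apply: gt0_ler_poweR => //.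
- by rewrite in_itv /= lee_fin m0 leey.
- by rewrite in_itv /= abse_ge0 leey.
rewrite (le_trans (martingale_max_ge m x))// lee_abs//.
Qed.

End martingale.
End haar_integral.

(** * Nörlund means on the Hardy space *)

Section norlund.
Variables (R : realType) (q : nat -> R).
Hypotheses (q_ge0 : forall k, 0 <= q k) (q0_gt0 : 0 < q 0%N).

Lemma norlund_abel m (T : nat -> R) : T 0%N = 0 ->
  \sum_(0 <= k < m.+1) q (m - k)%N * (T k.+1 - T k) =
  q 0%N * T m.+1 + \sum_(0 <= k < m) (q (m - k)%N - q (m - k.+1)%N) * T k.+1.
Proof.
move=> T0; under eq_bigr do rewrite mulrBr.
rewrite big_split/= sumrN big_nat_recr//= subnn.
rewrite [X in _ - X]big_nat_recl// T0 mulr0 add0r.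
under [X in _ = _ + X]eq_bigr do rewrite mulrBl.
by rewrite big_split/= sumrN; ring.
Qed.

Lemma norlund_weight_rev m :
  norlund_weight q m.+1 = \sum_(0 <= k < m.+1) q (m - k)%N.
Proof. by rewrite /norlund_weight big_nat_rev; apply: eq_bigr => k _; rewrite subSS. Qed.

Lemma norlund_weight_ge n : (0 < n)%N -> q 0%N <= norlund_weight q n.
Proof.
by case: n => // n _; rewrite /norlund_weight big_nat_recl// lerDl sumr_ge0.
Qed.

Lemma norlund_weight_gt0 n : (0 < n)%N -> 0 < norlund_weight q n.
Proof. by move=> n0; apply: lt_le_trans q0_gt0 (norlund_weight_ge n0). Qed.

(** Abel summation with [T k = k] expresses [Q_(m+1)] through the same differences without absolute
    values. For non-decreasing [q] the two sides agree; for non-increasing [q] the sign flips and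
    the sum equals [q_0 (m + 1) - Q_(m+1)]. *)
Lemma norlund_regular :
  (nonincreasing_seq q /\
     (fun n => q 0%N * n%:R / norlund_weight q n : R^o) =O_\oo (fun=> 1 : R^o))
  \/ nondecreasing_seq q ->
  exists2 C : R, 0 < C & forall m,
    q 0%N * m.+1%:R +
      \sum_(0 <= k < m) `|q (m - k)%N - q (m - k.+1)%N| * k.+1%:R <=
    C * norlund_weight q m.+1.
Proof.
have abel m : norlund_weight q m.+1 = q 0%N * m.+1%:R +
    \sum_(0 <= k < m) (q (m - k)%N - q (m - k.+1)%N) * k.+1%:R.
  rewrite norlund_weight_rev -(@norlund_abel m (fun k => k%:R))//.
  by apply: eq_bigr => k _; rewrite -natrB// subSnn mulr1.
case=> [[qdec /eqO_exP[C C0 [N _ CN]]]|qinc]; last first.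
  exists 1 => // m; rewrite mul1r abel lerD2l; apply: ler_sum => k _.
  by rewrite ger0_norm// subr_ge0; apply: qinc; exact: leq_sub2l.
(* [C] handles the indices from [N] on; below [N], the inequality [q_0 <= Q] suffices with factor
   [N]. The term [q_0 (m + 1)] occurs twice. *)
exists (2 * (C + N%:R)) => [|m]; first by rewrite mulr_gt0// ltr_wpDr.
have Q0 := norlund_weight_gt0 (ltn0Sn m).
have H : q 0%N * m.+1%:R <= (C + N%:R) * norlund_weight q m.+1.
  have [Nm|mN] := leqP N m.+1.
    have /= := CN m.+1 Nm; rewrite normr1 mulr1 ger0_norm; last first.
      by rewrite divr_ge0 ?mulr_ge0// ltW.
    rewrite ler_pdivrMr// => /le_trans; apply; rewrite ler_wpM2r ?(ltW Q0)//.
    by rewrite lerDl.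
  rewrite mulrC; apply: ler_pM; rewrite ?(ltW q0_gt0) ?ler0n//.
    rewrite (@le_trans _ _ N%:R) ?ler_nat ?(ltnW mN)// lerDr ltW//.
  exact: norlund_weight_ge.
have E : \sum_(0 <= k < m) `|q (m - k)%N - q (m - k.+1)%N| * k.+1%:R =
    q 0%N * m.+1%:R - norlund_weight q m.+1.
  rewrite abel opprD addNKr -sumrN; apply: eq_bigr => k _.
  rewrite -mulNr ler0_norm// subr_le0; apply: qdec; exact: leq_sub2l.
rewrite E; have := norlund_weight_gt0 (ltn0Sn m); lra.
Qed.

Lemma norlund_bound m (C Y : R) (S : nat -> R) : 0 <= Y ->
  q 0%N * m.+1%:R +
    \sum_(0 <= k < m) `|q (m - k)%N - q (m - k.+1)%N| * k.+1%:R <=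
    C * norlund_weight q m.+1 ->
  (forall k, (k <= m.+1)%N -> `|\sum_(0 <= j < k.+1) S j| <= k%:R * Y) ->
  `|(norlund_weight q m.+1)^-1 * \sum_(1 <= k < m.+2) q (m.+1 - k)%N * S k| <= C * Y.
Proof.
move=> Y0 HC HS; pose T k := \sum_(0 <= j < k.+1) S j.
have T0 : T 0%N = 0.
  by apply/eqP; rewrite -normr_le0 (le_trans (HS 0%N _))// mul0r.
have -> : \sum_(1 <= k < m.+2) q (m.+1 - k)%N * S k =
    \sum_(0 <= k < m.+1) q (m - k)%N * (T k.+1 - T k).
  rewrite big_add1/=; apply: eq_bigr => k _; rewrite subSS; congr (_ * _).
  by rewrite /T [in RHS]big_nat_recr//= addrAC subrr add0r.
have Q0 := norlund_weight_gt0 (ltn0Sn m).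
rewrite normrM ger0_norm ?invr_ge0 ?(ltW Q0)// ler_pdivrMl//.
rewrite norlund_abel// mulrA [_ * C]mulrC.
apply: le_trans (ler_wpM2r Y0 HC); rewrite mulrDl mulr_suml.
rewrite (le_trans (ler_normD _ _))// lerD//.
  rewrite normrM ger0_norm ?(ltW q0_gt0)// -mulrA ler_wpM2l ?(ltW q0_gt0)//.
  exact: HS.
rewrite (le_trans (ler_norm_sum _ _ _))//; apply: ler_sum_nat => k /andP[_ km].
rewrite normrM -mulrA ler_wpM2l//; apply: HS; exact: leqW.
Qed.

End norlund.

(** * The weak type inequality for the maximal operator *)

Section weak_bound.
Variables (R : realType) (mu : probability walsh_group R).
Hypothesis mu_haar : is_haar mu.
Variables (q : nat -> R).
Hypotheses (q_ge0 : forall k, 0 <= q k) (q0_gt0 : 0 < q 0%N).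

Lemma cylinder_norlund_mean f m n : (n <= 2 ^ m)%N ->
  cylinder m (norlund_mean mu q n f).
Proof.
move=> nm x y xy; rewrite /norlund_mean; congr (_ * _).
apply: eq_big_nat => k /andP[_ kn]; congr (_ * _).
apply: eq_big_nat => i /andP[_ ik]; congr (_ * _).
apply: (cylinder_kaczmarz R _ xy); lia.
Qed.

Lemma norlund_max_weak_type :
  (nonincreasing_seq q /\
     (fun n => q 0%N * n%:R / norlund_weight q n : R^o) =O_\oo (fun=> 1 : R^o))
  \/ nondecreasing_seq q ->
  exists2 K : R, 0 <= K & forall f, is_martingale mu f -> forall l, 0 < l ->
    ((l `^ 2^-1)%:E * mu [set x | (l%:E < `|norlund_max mu q f x|)%E] <=
     K%:E * \int[mu]_x (`|martingale_max f x| `^ 2^-1))%E.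
Proof.
move=> /(norlund_regular q_ge0 q0_gt0)[C C0 HC].
exists (1000 * Num.sqrt C); first exact: mulr_ge0 (ler0n _ _) (sqrtr_ge0 _).
move=> f mf l l0.
(* The level set for the orders [0 < n < 2 ^ m] depends on [m] coordinates only. These sets increase
   to the full level set, so a bound uniform in [m] passes to the limit. *)
pose P m x := [exists n : 'I_(2 ^ m), (0 < n)%N && (l < `|norlund_mean mu q n f x|)].
have Pc m : cylinder m (P m).
  move=> x y xy; apply: eq_existsb => n.
  by rewrite (cylinder_norlund_mean _ (ltnW (ltn_ord n)) xy).
set I := (\int[mu]_x _)%E.
have Pb m : (mu [set x | P m x] <= (1000 * Num.sqrt C / Num.sqrt l)%:E * I)%E.
  rewrite (measure_cylinder mu_haar (Pc m)).
  have [G [G0 HG weakG]] := fejer_domination (martingale_cylinder mf)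
    (martingale_avg mu_haar mf) m.
  have lC : 0 < l / C by rewrite divr_gt0.
  apply: (@le_trans _ _ ((1000 / Num.sqrt (l / C)) *
      mean m (fun t => Num.sqrt (running_max f m t)))%:E).
    rewrite lee_fin; apply: le_trans (weakG _ lC); apply: ler_mean => x.
    suff : P m x -> l / C < G x by case: (P m x) => // ->.
    move=> /existsP[[[|n] nm]]//= H; rewrite ltr_pdivrMr// mulrC.
    apply: (lt_le_trans H); rewrite /norlund_mean.
    apply: norlund_bound => // k kn.
    have km : (k < 2 ^ m)%N by exact: leq_ltn_trans nm.
    apply: le_trans (HG k x km); rewrite le_eqVlt; apply/orP; left; apply/eqP.
    congr `|_|; apply: eq_big_nat => j /andP[_ jk].
    by rewrite (kaczmarz_sumE mu_haar mf (m := m))//; lia.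
  rewrite EFinM.
  have -> : 1000 / Num.sqrt (l / C) = 1000 * Num.sqrt C / Num.sqrt l.
    rewrite sqrtrM ?(ltW l0)// sqrtrV ?(ltW C0)// invfM invrK; ring.
  apply: lee_wpmul2l; last first.
    rewrite (_ : (fun t => _) = fun t => running_max f m t `^ 2^-1).
      by apply: mean_running_max_le => //; rewrite invr_ge0.
    by apply/funext => t; rewrite powR12_sqrt// running_max_ge0.
  rewrite lee_fin; apply: divr_ge0 (sqrtr_ge0 _).
  exact: mulr_ge0 (ler0n _ _) (sqrtr_ge0 _).
have -> : [set x | (l%:E < `|norlund_max mu q f x|)%E] = \bigcup_m [set x | P m x].
  have M0 x : (0 <= norlund_max mu q f x)%E.
    apply: (@le_trans _ _ `|norlund_mean mu q 1 f x|%:E); first by rewrite lee_fin.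
    by apply: ereal_sup_ubound; exists 1%N.
  apply/seteqP; split => x /=; rewrite gee0_abs//.
    move=> /ereal_sup_gt[_ [n n1 <-]]; rewrite lte_fin => ln.
    exists n => //; apply/existsP; exists (Ordinal (ltn_expl n (ltnSn 1))) => /=.
    by rewrite n1.
  move=> [m _ /existsP[n /andP[n0 ln]]].
  apply: (@lt_le_trans _ _ `|norlund_mean mu q n f x|%:E); first by rewrite lte_fin.
  by apply: ereal_sup_ubound; exists (n : nat).
have mP m : measurable [set x | P m x].
  by apply: (@cylinder_measurable m) => x y xy; apply/propext; rewrite /= (Pc m x y xy).
have mU : measurable (\bigcup_m [set x | P m x]) by exact: bigcup_measurable.
have ndP : {homo (fun m => [set x | P m x]) : n m / (n <= m)%N >-> (n <= m)%O}.
  move=> n m nm; apply/subsetPset => x /existsP[k Hk]; apply/existsP.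
  have km : (k < 2 ^ m)%N by rewrite (leq_trans (ltn_ord k))// leq_exp2l.
  by exists (Ordinal km).
have cP := nondecreasing_cvg_mu (mu := mu) mP mU ndP.
have : (mu (\bigcup_m [set x | P m x]) <= (1000 * Num.sqrt C / Num.sqrt l)%:E * I)%E.
  by apply: (cvge_le _ cP); apply: nearW => m; exact: Pb.
have s0 : 0 < Num.sqrt l by rewrite sqrtr_gt0.
rewrite powR12_sqrt ?(ltW l0)// => H.
have := @lee_wpmul2l _ (Num.sqrt l)%:E _ _ _ H; rewrite lee_fin => /(_ (ltW s0)).
move=> /le_trans; apply; rewrite muleA -EFinM.
by rewrite mulrC divfK// gt_eqF.
Qed.

Lemma norlund_max_bounded :
  (nonincreasing_seq q /\
     (fun n => q 0%N * n%:R / norlund_weight q n : R^o) =O_\oo (fun=> 1 : R^o))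
  \/ nondecreasing_seq q ->
  bounded_Hp_weak_Lp mu 2^-1 (norlund_max mu q).
Proof.
move=> /norlund_max_weak_type[K K0 H].
(* Both quasi-norms are powers of exponent [(2^-1)^-1] of the quantities compared in
   [norlund_max_weak_type]. *)
exists (K `^ (2^-1)^-1) => f [mf _].
rewrite /weak_Lp_norm /Hp_norm unlock -poweR_EFin.
have I0 : (0 <= \int[mu]_x (`|martingale_max f x| `^ 2^-1))%E.
  by apply: integral_ge0 => x _; exact: poweR_ge0.
rewrite -poweRM ?lee_fin//; apply: gt0_ler_poweR.
- by rewrite invr_ge0 invr_ge0.
- rewrite in_itv /= leey andbT; apply: le_ereal_sup_tmp.
  eexists; first by exists 1%R => //=; exact: ltr01.
  by rewrite mule_ge0 ?lee_fin ?powR_ge0.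
- by rewrite in_itv /= leey andbT mule_ge0 ?lee_fin.
by apply: ge_ereal_sup => _ [l /= l0 <-]; exact: H.
Qed.

End weak_bound.

(** * Lacunary martingales *)

Section powR_facts.
Variable R : realType.

(** Since [t <= t ^ p] for [t] in [[0, 1]], the fractions [a / (a + b)] and [b / (a + b)] have
    [p]-th powers summing to at least [1]. *)
Lemma powR_subadd (p a b : R) : 0 < p <= 1 -> 0 <= a -> 0 <= b ->
  (a + b) `^ p <= a `^ p + b `^ p.
Proof.
move=> /andP[p0 p1] a0 b0.
have [s0|s0] := leP (a + b) 0.
  have -> : a + b = 0 by lra.
  by rewrite powR0 ?gt_eqF// addr_ge0// powR_ge0.
have H c : 0 <= c -> c <= a + b -> c / (a + b) * (a + b) `^ p <= c `^ p.
  move=> c0 cs; have [->|cn0] := eqVneq c 0; first by rewrite !mul0r powR_ge0.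
  have cp : 0 < c by rewrite lt_neqAle eq_sym cn0.
  rewrite -[c in leRHS](@divfK _ (a + b)) ?gt_eqF// powRM ?divr_ge0// ?(ltW s0)//.
  rewrite ler_wpM2r ?powR_ge0// ger1_powR// divr_gt0//=.
  by rewrite ler_pdivrMr// mul1r.
apply: le_trans (lerD (H a a0 _) (H b b0 _)); [|lra|lra].
by rewrite -mulrDl -mulrDl divff ?gt_eqF// mul1r.
Qed.

Lemma powR_sum_subadd (p : R) (F : nat -> R) n : 0 < p <= 1 -> (forall j, 0 <= F j) ->
  (\sum_(0 <= j < n) F j) `^ p <= \sum_(0 <= j < n) F j `^ p.
Proof.
move=> p01 F0; elim: n => [|n IH].
  by rewrite !big_geq// powR0// gt_eqF//; case/andP: p01.
rewrite !big_nat_recr//= (le_trans (powR_subadd p01 _ (F0 n)))//.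
  exact: sumr_ge0.
by rewrite lerD2r.
Qed.

Lemma exprn_unbounded (g M : R) : 1 < g -> exists n0, forall n, (n0 <= n)%N -> M <= g ^+ n.
Proof.
move=> g1.
(* A weak form of Bernoulli's inequality. *)
have B n : n%:R * (g - 1) <= g ^+ n.
  elim: n => [|n IH]; first by rewrite mul0r.
  rewrite exprS -natr1; have : 1 <= g ^+ n by rewrite exprn_ege1// ltW.
  by nra.
exists (Num.bound (`|M| / (g - 1))) => n n0.
apply: le_trans (B n); rewrite (le_trans (ler_norm M))// -ler_pdivrMr ?subr_gt0//.
have M0 : 0 <= `|M| / (g - 1) by rewrite divr_ge0// subr_ge0 ltW.
by rewrite (le_trans (ltW (archi_boundP M0)))// ler_nat.
Qed.

End powR_facts.

Section lacunary.
Variables (R : realType) (c : nat -> R).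
Hypothesis c_ge0 : forall n, 0 <= c n.
Implicit Types x : walsh_group.

(** The Dirichlet kernel of order [2 ^ n]: it is [2 ^ n] where the first [n] coordinates vanish, and
    [0] elsewhere. *)
Fixpoint spike (n : nat) x : R :=
  if n is m.+1 then if x m then 0 else 2 * spike m x else 1.

Lemma spike_ge0 n x : 0 <= spike n x.
Proof. by elim: n => //= n IH; case: (x n) => //; rewrite mulr_ge0. Qed.

Lemma cylinder_spike n : cylinder n (spike n).
Proof.
elim: n => //= n IH x y xy; rewrite xy// (IH x y)// => i ni.
by apply: xy; exact: ltnW.
Qed.

Lemma spike_flip_avg n : flip_avg n (spike n.+1) = spike n.
Proof.
apply/funext => x; rewrite /flip_avg /= coordv_eq.
rewrite (cylinder_coordv _ (@cylinder_spike n))//.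
by case: (x n) => /=; field.
Qed.

Lemma mean_spike n : mean n (spike n) = 1.
Proof. by elim: n => [//|n IH]; rewrite meanS spike_flip_avg. Qed.

Lemma spike_support n x : spike n x != 0 -> dyadic_interval n 0 x.
Proof.
elim: n => [_ i //|n IH] /=; case: ifPn => [_|xn]; first by rewrite eqxx.
rewrite mulf_eq0 pnatr_eq0/= => /IH h i; rewrite ltnS leq_eqVlt => /orP[/eqP->|]; last exact: h.
by rewrite (negbTE xn).
Qed.

Lemma mean_spike_powR (p : R) n : p != 0 ->
  mean n (fun x => spike n x `^ p) = (2 `^ p / 2) ^+ n.
Proof.
move=> p0; elim: n => [|n IH]; first by rewrite /mean /= powR1.
rewrite meanS (_ : flip_avg _ _ = fun x => 2 `^ p / 2 * spike n x `^ p).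
  by rewrite meanZ IH exprS.
apply/funext => x; rewrite /flip_avg /= coordv_eq.
rewrite (cylinder_coordv _ (@cylinder_spike n))//.
by case: (x n); rewrite /= powR0// powRM ?spike_ge0//; field.
Qed.

Definition lacunary (n : nat) x : R :=
  \sum_(0 <= j < n) c j * spike j x * rademacher R j x.

Lemma lacunaryS n x :
  lacunary n.+1 x = lacunary n x + c n * spike n x * rademacher R n x.
Proof. by rewrite /lacunary big_nat_recr. Qed.

Lemma cylinder_lacunary n : cylinder n (lacunary n).
Proof.
move=> x y xy; apply: eq_big_nat => j /andP[_ jn].
rewrite (cylinder_le (ltnW jn) (@cylinder_spike j) xy).
by rewrite (cylinder_rad R jn xy).
Qed.

Lemma lacunary_flip_avg n : flip_avg n (lacunary n.+1) = lacunary n.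
Proof.
apply/funext => x; rewrite /flip_avg !lacunaryS.
rewrite (cylinder_coordv _ (@cylinder_lacunary n))//.
rewrite (cylinder_coordv _ (@cylinder_spike n))//.
by rewrite !radE coordv_eq; case: (x n) => /=; field.
Qed.

Lemma lacunary_norm_le n x : `|lacunary n x| <= \sum_(0 <= j < n) c j * spike j x.
Proof.
rewrite (le_trans (ler_norm_sum _ _ _))//; apply: ler_sum => j _.
by rewrite normrM rad_norm mulr1 ger0_norm// mulr_ge0// spike_ge0.
Qed.

Lemma lacunary0 n : lacunary n 0 = \sum_(0 <= j < n) c j * 2 ^+ j.
Proof.
apply: eq_bigr => j _; rewrite radE /= mulr1; congr (_ * _).
by elim: j => //= j ->; rewrite exprS.
Qed.

Variable mu : probability walsh_group R.
Hypothesis mu_haar : is_haar mu.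

Lemma lacunary_martingale : is_martingale mu lacunary.
Proof. exact: (cylinder_martingale mu_haar cylinder_lacunary lacunary_flip_avg). Qed.

(** The terms below level [i] are orthogonal to [r_i]. In the term of level [i] the two factors
    [r_i] cancel, and [psi R i j] is [1] on the support of the spike, whose mean is [1]. *)
Lemma lacunary_coef i j : (j < 2 ^ i)%N -> kaczmarz_coef mu lacunary (2 ^ i + j) = c i.
Proof.
move=> ji; rewrite (kaczmarz_coefE mu_haar lacunary_martingale (m := i.+1)); last first.
  by rewrite expnS; lia.
rewrite (_ : (fun t => _) = fun t =>
    lacunary i t * psi R i j t * rademacher R i t + c i * spike i t); last first.
  apply/funext => t; rewrite kaczmarz_block// lacunaryS.
  have rr : rademacher R i t * rademacher R i t = 1.
    by rewrite radE; case: (t i); ring.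
  have sp : spike i t * psi R i j t = spike i t.
    have [->|/spike_support ti] := eqVneq (spike i t) 0; first by rewrite mul0r.
    by rewrite (@cylinder_psi R i j 0 t)// psi0 mulr1.
  rewrite mulrDl; congr (_ + _); first by ring.
  transitivity (c i * (spike i t * psi R i j t) * (rademacher R i t * rademacher R i t)).
    by ring.
  by rewrite sp rr mulr1.
rewrite meanD meanZ (@mean_stable _ i i.+1 (spike i))//; last exact: cylinder_spike.
rewrite mean_spike mulr1 (@mean_odd _ i) ?add0r//.
- exact: cylinder_op2 (@cylinder_lacunary i) (@cylinder_psi R i j).
- exact: cylinder_rad.
- exact: rad_flip_avg.
Qed.

Lemma lacunary_coef0 : kaczmarz_coef mu lacunary 0 = 0.
Proof.
rewrite (kaczmarz_coefE mu_haar lacunary_martingale (m := 0)) ?expn0//.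
by rewrite /mean /= /lacunary big_geq// mul0r.
Qed.

(** Block [j] consists of [2 ^ j] coefficients, all equal to [c j]. *)
Lemma lacunary_sum_le k n x : (k <= 2 ^ n)%N ->
  `|kaczmarz_sum mu k lacunary x| <= \sum_(0 <= j < n) c j * 2 ^+ j.
Proof.
move=> kn; apply: (@le_trans _ _ (\sum_(0 <= i < 2 ^ n) `|kaczmarz_coef mu lacunary i|)).
  rewrite /kaczmarz_sum (le_trans (ler_norm_sum _ _ _))//.
  rewrite [leRHS](big_cat_nat (leq0n _) kn)//= ler_wpDr ?sumr_ge0//.
  by apply: ler_sum => i _; rewrite normrM kaczmarz_norm mulr1.
elim: n {k kn} => [|n IH].
  by rewrite expn0 big_nat1 lacunary_coef0 normr0 big_geq.
rewrite big_nat_recr//= (@big_cat_nat _ _ _ (2 ^ n))//=; last by rewrite leq_exp2l.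
rewrite lerD// -{1}[(2 ^ n)%N]add0n big_addn expnS mul2n -addnn addnK.
rewrite big_nat (eq_bigr (fun=> c n)); last first.
  by move=> i /andP[_ ni]; rewrite addnC lacunary_coef// ger0_norm.
by rewrite -big_nat sumr_const_nat subn0 -[leLHS]mulr_natr natrX.
Qed.

Variable q : nat -> R.
Hypotheses (q_ge0 : forall k, 0 <= q k) (q0_gt0 : 0 < q 0%N).
Hypothesis q_le : forall n, norlund_weight q n <= n%:R * q 0%N.

(** Only the last partial sum reaches index [2 ^ n], where the term has modulus [c n] and weight
    [q_0 / Q]; here [Q <= (2 ^ n + 1) q_0 <= 2 ^ n.+1 q_0]. Everything else is an average, with
    weights of total [1], of quantities bounded by [Gam]. *)
Lemma lacunary_norlund_ge n x :
  c n / 2 ^+ n.+1 - \sum_(0 <= j < n) c j * 2 ^+ j <=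
  `|norlund_mean mu q (2 ^ n).+1 lacunary x|.
Proof.
set Gam := \sum_(0 <= j < n) _.
have G0 : 0 <= Gam by apply: sumr_ge0 => j _; rewrite mulr_ge0// exprn_ge0.
have Q0 := norlund_weight_gt0 q_ge0 q0_gt0 (ltn0Sn (2 ^ n)).
rewrite /norlund_mean normrM ger0_norm ?invr_ge0 ?(ltW Q0)// [leRHS]mulrC ler_pdivlMr//.
rewrite big_nat_recr ?ltn0Sn//= subnn.
have SE : kaczmarz_sum mu (2 ^ n).+1 lacunary x =
    kaczmarz_sum mu (2 ^ n) lacunary x + c n * kaczmarz R (2 ^ n) x.
  rewrite /kaczmarz_sum big_nat_recr//=; congr (_ + _ * _).
  by have := @lacunary_coef n 0; rewrite addn0; apply; rewrite expn_gt0.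
rewrite SE mulrDr addrA.
set B := \sum_(1 <= k < _) _ + _.
have HB : `|B| <= norlund_weight q (2 ^ n).+1 * Gam.
  rewrite norlund_weight_rev mulr_suml big_nat_recr//= subnn.
  rewrite (le_trans (ler_normD _ _))// lerD//; last first.
    by rewrite normrM ger0_norm ?(ltW q0_gt0)// ler_wpM2l ?(ltW q0_gt0)// lacunary_sum_le.
  rewrite big_add1/= (le_trans (ler_norm_sum _ _ _))//; apply: ler_sum_nat => k /andP[_ kn].
  by rewrite subSS normrM ger0_norm// ler_wpM2l// lacunary_sum_le.
have H1 : q 0%N * c n - `|B| <= `|B + q 0%N * (c n * kaczmarz R (2 ^ n) x)|.
  have E : `|q 0%N * (c n * kaczmarz R (2 ^ n) x)| = q 0%N * c n.
    by rewrite !normrM kaczmarz_norm mulr1 !ger0_norm// ltW.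
  by rewrite -E [X in _ <= `|X|]addrC; exact: lerB_normD.
apply: le_trans H1; rewrite mulrBl lerB//; last by rewrite mulrC.
rewrite mulrAC ler_pdivrMr ?exprn_gt0// mulrC -mulrA [c n * _]mulrC mulrA ler_wpM2r//.
rewrite (le_trans (q_le _))// mulrC ler_wpM2l ?(ltW q0_gt0)//.
rewrite -natrX ler_nat expnS; have := expn_gt0 2 n; lia.
Qed.

Variable p : R.
Hypothesis p01 : 0 < p <= 1.

(** By subadditivity of the [p]-th power, the maximal function to the power [p] is at most the sum
    of all [(c j * spike j x) ^ p], which is integrated term by term by monotone convergence. *)
Lemma lacunary_Hp_lty (B : R) :
  (forall n, \sum_(0 <= j < n) c j `^ p * (2 `^ p / 2) ^+ j <= B) ->
  (Hp_norm mu p lacunary < +oo)%E.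
Proof.
move=> HB; have p0 : 0 < p by case/andP: p01.
rewrite /Hp_norm unlock; apply: poweR_lty.
pose H n x : R := \sum_(0 <= j < n) (c j * spike j x) `^ p.
have Hc n : cylinder n (H n).
  move=> x y xy; apply: eq_big_nat => j /andP[_ jn].
  by rewrite (cylinder_le (ltnW jn) (@cylinder_spike j) xy).
have mH n : measurable_fun [set: walsh_group] (fun x => (H n x)%:E).
  by apply/measurable_EFinP; exact: (cylinder_measurable_fun (Hc n)).
have H0 n x : 0 <= H n x by apply: sumr_ge0 => j _; exact: powR_ge0.
have Hnd x : {homo (fun n => (H n x)%:E) : n m / (n <= m)%N >-> (n <= m)%E}.
  move=> n m nm; rewrite lee_fin /H [leRHS](big_cat_nat (leq0n _) nm)//=.
  by rewrite ler_wpDr ?sumr_ge0// => j _; exact: powR_ge0.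
have cH x : (H n x)%:E @[n --> \oo] --> ereal_sup (range (fun n => (H n x)%:E)).
  by apply: ereal_nondecreasing_cvgn => n m nm; exact: Hnd.
have mcv := @monotone_convergence _ _ R mu setT measurableT (fun n x => (H n x)%:E) mH
  (fun n x _ => H0 n x) (fun x _ => Hnd x).
apply: (@le_lt_trans _ _ (\int[mu]_x limn (fun n => (H n x)%:E))%E).
  apply: ge0_le_integral => //.
  - by move=> x _; exact: poweR_ge0.
  - apply: (measurableT_comp (measurable_poweR _)); apply: measurableT_comp => //.
    exact: (martingale_max_measurable lacunary_martingale).
  - apply: (emeasurable_fun_cvg (fun n x => (H n x)%:E)) => // x _.
    exact: (cvgP _ (cH x)).
  move=> x _; rewrite (cvg_lim _ (cH x))//; set L := ereal_sup _.
  have L0 : (0 <= L)%E 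
    by apply: le_ereal_sup_tmp; exists (H 0%N x)%:E; [exists 0%N|rewrite lee_fin].
  have M0 : (0 <= martingale_max lacunary x)%E.
    apply: (@le_trans _ _ `|lacunary 0 x|%:E); first by rewrite lee_fin.
    by apply: ereal_sup_ubound; exists 0%N.
  have ML : (martingale_max lacunary x <= L `^ p^-1)%E.
    apply: ge_ereal_sup => _ [n _ <-].
    have -> : (`|lacunary n x|%:E = ((`|lacunary n x| `^ p)%:E) `^ p^-1)%E.
      by rewrite poweR_EFin -powRrM mulfV ?gt_eqF// powRr1.
    apply: gt0_ler_poweR; rewrite ?in_itv/= ?invr_ge0 ?(ltW p0) ?lee_fin ?powR_ge0 ?leey ?L0//.
    apply: (@le_trans _ _ (H n x)%:E); last by apply: ereal_sup_ubound; exists n.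
    rewrite lee_fin; apply: le_trans (powR_sum_subadd n p01 _); last first.
      by move=> j; rewrite mulr_ge0// spike_ge0.
    apply: ge0_ler_powR; rewrite ?nnegrE ?(ltW p0) ?sumr_ge0//.
      by move=> j _; rewrite mulr_ge0// spike_ge0.
    exact: lacunary_norm_le.
  rewrite gee0_abs//; apply: (@le_trans _ _ ((L `^ p^-1) `^ p)%E).
    apply: gt0_ler_poweR; rewrite ?in_itv/= ?(ltW p0) ?leey ?M0 ?poweR_ge0//.
  by rewrite -poweRrM mulVf ?gt_eqF// poweRe1.
rewrite mcv; apply: (@le_lt_trans _ _ B%:E); last exact: ltry.
have IE n : (\int[mu]_x (H n x)%:E = (mean n (H n))%:E)%E.
  exact: (integral_cylinder mu_haar (Hc n)).
apply: lime_le.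
  apply: ereal_nondecreasing_is_cvgn => n m nm; apply: ge0_le_integral => //.
    by move=> x _; rewrite lee_fin.
  by move=> x _; exact: Hnd.
apply: nearW => n; rewrite IE lee_fin mean_sum; apply: le_trans (HB n).
apply: ler_sum_nat => j /andP[_ jn]; rewrite le_eqVlt; apply/orP; left; apply/eqP.
rewrite -mean_spike_powR ?gt_eqF// -meanZ (@mean_stable _ j n) ?(ltnW jn)//.
  by congr mean; apply/funext => x; rewrite powRM// spike_ge0.
exact: (cylinder_comp (fun a => (c j * a) `^ p) (@cylinder_spike j)).
Qed.

(** At the point [0] all terms are nonnegative and that of level [n] is positive; the dyadic
    interval around [0] has positive measure. *)
Lemma lacunary_Hp_gt0 n : 0 < c n -> (0 < Hp_norm mu p lacunary)%E.
Proof.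
move=> cn; have p0 : 0 < p by case/andP: p01.
rewrite /Hp_norm unlock; apply: poweR_gt0.
apply: lt_le_trans (mean_running_max_le mu_haar lacunary_martingale n.+1 (ltW p0)).
pose g x := running_max lacunary n.+1 x `^ p.
have gc : cylinder n.+1 g.
  exact: (cylinder_comp (fun a => a `^ p) (cylinder_running_max cylinder_lacunary (m := n.+1))).
have g0 x : 0 <= g x by exact: powR_ge0.
rewrite lte_fin -/g; have := ler_mean_pt 0 g0 gc.
rewrite -(@pmulr_rgt0 _ (2 ^+ n.+1)) ?exprn_gt0//; apply: lt_le_trans.
apply: powR_gt0; rewrite running_maxS lt_max; apply/orP; right.
rewrite lacunary0 normr_gt0 gt_eqF// big_nat_recr//=.
rewrite ltr_wpDl ?mulr_gt0 ?exprn_gt0//; apply: sumr_ge0 => j _.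
by rewrite mulr_ge0// exprn_ge0.
Qed.

End lacunary.

(** * Divergence *)

Section greedy.
Variables (R : realType) (A : R).
Hypothesis A2 : 2 < A.

(* The state is the number of levels selected so far together with the bound
   [\sum_j c_j 2 ^ j] on the contribution of these levels; a level is selected
   as soon as its own contribution beats that bound by the number of levels
   selected so far. *)
Let hit_state (s : nat * R) (n : nat) : bool :=
  s.1%:R + s.2 <= A ^+ n / 2 ^+ s.1 / 2 ^+ n.+1.

Let Fixpoint state (n : nat) : nat * R :=
  if n is m.+1 then
    if hit_state (state m) m then
      ((state m).1.+1, (state m).2 + A ^+ m / 2 ^+ (state m).1 * 2 ^+ m)
    else state m
  else (0%N, 0).

Let hit n := hit_state (state n) n.

(** The growth [A ^+ n] will be critical for the [H_p] quasi-norm; the division by [2] to the number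
    of earlier selections supplies the decay that makes the quasi-norm finite. *)
Definition greedy_coef n : R := if hit n then A ^+ n / 2 ^+ (state n).1 else 0.

Lemma greedy_coef_ge0 n : 0 <= greedy_coef n.
Proof.
rewrite /greedy_coef; case: ifP => // _.
by rewrite divr_ge0 ?exprn_ge0//; have := A2; lra.
Qed.

Let state_sum n : (state n).2 = \sum_(0 <= j < n) greedy_coef j * 2 ^+ j.
Proof.
elim: n => [|n IH] /=; first by rewrite big_geq.
by rewrite big_nat_recr//= -IH /greedy_coef /hit; case: ifP => _ //=; rewrite mul0r addr0.
Qed.

(** Without a further selection the state would stay constant, while the right side of the selection
    test grows like [(A / 2) ^ d]; the test would then succeed after all. *)
Let hit_next n : exists n', (n <= n')%N /\ hit n' /\ state n' = state n.
Proof.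
have A21 : 1 < A / 2 by rewrite ltr_pdivlMr// mul1r.
have [n0 Hn0] := exprn_unbounded
  (((state n).1%:R + (state n).2) * (2 ^+ (state n).1 * 2)) A21.
have big d : (n0 <= d)%N -> hit_state (state n) d.
  move=> /Hn0 H; rewrite /hit_state exprS.
  have -> : A ^+ d / 2 ^+ (state n).1 / (2 * 2 ^+ d) =
      (A / 2) ^+ d / (2 ^+ (state n).1 * 2).
    by rewrite expr_div_n; field; rewrite !expf_neq0.
  by rewrite ler_pdivlMr// mulr_gt0// exprn_gt0.
have [//|H] := pselect (exists n', (n <= n')%N /\ hit n' /\ state n' = state n).
have stable d : state (n + d) = state n.
  elim: d => [|d IH]; first by rewrite addn0.
  rewrite addnS /=; case: ifPn => // h; exfalso; apply: H.
  by exists (n + d)%N; rewrite leq_addr /hit h IH.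
exfalso; apply: H; exists (n + n0)%N; rewrite leq_addr /hit !stable.
by split => //; split => //; apply: big; exact: leq_addl.
Qed.

Lemma greedy_hit k : exists n, 0 < greedy_coef n /\
  k%:R <= greedy_coef n / 2 ^+ n.+1 - \sum_(0 <= j < n) greedy_coef j * 2 ^+ j.
Proof.
have [n stn] : exists n, (state n).1 = k.
  elim: k => [|k [n IH]]; first by exists 0%N.
  have [n' [_ [h E]]] := hit_next n; exists n'.+1 => /=.
  by rewrite -/(hit n') h /= E IH.
have [n' [_ [h E]]] := hit_next n; exists n'.
have cE : greedy_coef n' = A ^+ n' / 2 ^+ (state n').1 by rewrite /greedy_coef h.
split; first by rewrite cE divr_gt0 ?exprn_gt0//; have := A2; lra.
rewrite -state_sum lerBrDr cE; move: h; rewrite /hit /hit_state {1}E stn.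
by [].
Qed.

(** By the choice of [A] the powers depending on the level cancel, and each selected level
    contributes [rho] to the number of earlier selections: a geometric series. *)
Lemma greedy_summable (p : R) n : 0 < p -> A `^ p * (2 `^ p / 2) = 1 ->
  \sum_(0 <= j < n) greedy_coef j `^ p * (2 `^ p / 2) ^+ j <=
  (1 - 2^-1 `^ p)^-1.
Proof.
move=> p0 Ap; set rho := 2^-1 `^ p.
have rho0 : 0 < rho by apply: powR_gt0; rewrite invr_gt0.
have rho1 : rho < 1.
  rewrite -[ltRHS](_ : 1 `^ p = 1); last by rewrite powR1.
  by apply: gt0_ltr_powR; rewrite ?nnegrE ?invr_ge0 ?invf_lt1 ?ltr1n.
have E : \sum_(0 <= j < n) greedy_coef j `^ p * (2 `^ p / 2) ^+ j =
    (1 - rho ^+ (state n).1) / (1 - rho).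
  elim: n => [|n IH]; first by rewrite big_geq// expr0 subrr mul0r.
  rewrite big_nat_recr//= IH /greedy_coef -/(hit n); case: (hit n) => /=; last first.
    by rewrite powR0 ?gt_eqF// mul0r addr0.
  have -> : (A ^+ n / 2 ^+ (state n).1) `^ p * (2 `^ p / 2) ^+ n = rho ^+ (state n).1.
    rewrite powRM ?invr_ge0 ?exprn_ge0//; last by have := A2; lra.
    rewrite mulrAC -[A ^+ n]powR_mulrn; last by have := A2; lra.
    rewrite powRAC powR_mulrn ?powR_ge0// -exprMn Ap expr1n mul1r.
    by rewrite -exprVn -[_ ^+ _]powR_mulrn ?invr_ge0// powRAC powR_mulrn ?powR_ge0.
  rewrite exprS; field; lra.
rewrite E ler_pdivrMr ?subr_gt0// mulVf; last by rewrite subr_eq0 gt_eqF.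
by rewrite gerBl exprn_ge0// ltW.
Qed.

End greedy.

(** * One martingale with unbounded means, and the conclusion *)

Lemma norlund_unbounded (R : realType) (mu : probability walsh_group R)
    (mu_haar : is_haar mu) (q : nat -> R) (q_ge0 : forall k, 0 <= q k)
    (q0_gt0 : 0 < q 0%N) (q_le : forall n, norlund_weight q n <= n%:R * q 0%N) (p : R) :
  0 < p < 2^-1 ->
  exists f, in_Hp mu p f /\ (0 < Hp_norm mu p f)%E /\
    ereal_sup [set (weak_Lp_norm mu p (EFin \o norlund_mean mu q n f)
                     / Hp_norm mu p f)%E | n in [set n | (1 <= n)%N]]
    = +oo%E.
Proof.
move=> /andP[p0 p12]; have p01 : 0 < p <= 1 by apply/andP; split => //; lra.
(* This growth rate exactly balances the factor [2 ^ p / 2] by which the mean of [spike n x ^ p]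
   changes per level; [p < 1/2] is what makes it exceed [2]. *)
pose A : R := 2 `^ (p^-1 - 1).
have A2 : 2 < A.
  have pV : 2 < p^-1 by rewrite -[2]invrK ltf_pV2 ?posrE ?invr_gt0.
  rewrite -[X in X < _](powRr1 (ler0n R 2)) /A /powR pnatr_eq0/= ltr_expR.
  by rewrite ltr_pM2r ?ln_gt0 ?ltr1n//; lra.
have Ap : A `^ p * (2 `^ p / 2) = 1.
  rewrite /A -powRrM mulrBl mulVf ?gt_eqF// mul1r powRB ?pnatr_eq0 ?implybT//.
  rewrite powRr1//; field; rewrite gt_eqF// powR_gt0//.
pose c := greedy_coef A; pose f := lacunary c.
have c0 n : 0 <= c n := greedy_coef_ge0 A2 n.
have fm : is_martingale mu f := lacunary_martingale c mu_haar.
have Hlt : (Hp_norm mu p f < +oo)%E.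
  by apply: (lacunary_Hp_lty c0 mu_haar p01) => n; exact: (greedy_summable A2 n p0 Ap).
have [n0 [cn0 _]] := greedy_hit A2 0.
have Hgt : (0 < Hp_norm mu p f)%E := lacunary_Hp_gt0 c0 mu_haar p01 cn0.
exists f; split => //; split => //.
have [h hE] : exists h, Hp_norm mu p f = h%:E.
  by move: Hlt Hgt; case: (Hp_norm mu p f) => [h| |]// _ _; exists h.
have h0 : 0 < h by move: Hgt; rewrite hE lte_fin.
apply/eqyP => a a0; rewrite hE.
(* The lower bound [k] then exceeds [a * h] at every point, so the level set at [a * h] is the whole
   group, of measure [1]. *)
pose k := Num.bound (2 * a * h).
have ka : 2 * a * h < k%:R by apply: archi_boundP; rewrite !mulr_ge0// ltW.
have k0 : 0 < k%:R :> R by rewrite (le_lt_trans _ ka)// !mulr_ge0// ltW.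
have [n [_ Hn]] := greedy_hit A2 k.
apply: le_ereal_sup_tmp; eexists; first by exists (2 ^ n).+1.
have lb x : k%:R <= `|norlund_mean mu q (2 ^ n).+1 f x|.
  exact: le_trans Hn (lacunary_norlund_ge c0 mu_haar q_ge0 q0_gt0 q_le n x).
rewrite inver gt_eqF// lee_pdivlMr// -EFinM.
have l0 : 0 < a * h by rewrite mulr_gt0.
have -> : (a * h)%:E = (((a * h) `^ p)%:E `^ p^-1)%E.
  by rewrite poweR_EFin -powRrM mulfV ?gt_eqF// powRr1// ltW.
rewrite /weak_Lp_norm; apply: gt0_ler_poweR.
- by rewrite invr_ge0 ltW.
- by rewrite in_itv /= leey lee_fin powR_ge0.
- rewrite in_itv /= leey andbT; apply: le_ereal_sup_tmp.
  eexists; first by exists 1%R => //=; exact: ltr01.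
  by rewrite mule_ge0 ?lee_fin ?powR_ge0.
apply: le_ereal_sup_tmp; eexists; first by exists (a * h).
rewrite [X in mu X](_ : _ = setT); first by rewrite probability_setT mule1.
apply/seteqP; split => // x _ /=; rewrite lte_fin.
by apply: lt_le_trans (lb x); lra.
Qed.

Theorem theorem1 (R : realType) (mu : probability walsh_group R)
    (mu_haar : is_haar mu) (q : nat -> R)
    (q_ge0 : forall k, 0 <= q k) (q0_gt0 : 0 < q 0%N) :
  ((nonincreasing_seq q /\
      (fun n => q 0%N * n%:R / norlund_weight q n : R^o) =O_\oo
        (fun=> 1 : R^o))
     \/ nondecreasing_seq q ->
   bounded_Hp_weak_Lp mu 2^-1 (norlund_max mu q))
  /\
  (forall p : R, 0 < p < 2^-1 ->
     (nondecreasing_seq q /\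
        forall n, (1 <= n)%N -> n%:R^-1 <= q 0%N / norlund_weight q n)
     \/ nonincreasing_seq q ->
     exists f, in_Hp mu p f /\ (0 < Hp_norm mu p f)%E /\
       ereal_sup [set (weak_Lp_norm mu p (EFin \o norlund_mean mu q n f)
                        / Hp_norm mu p f)%E | n in [set n | (1 <= n)%N]]
       = +oo%E).
Proof.
split; first exact: norlund_max_bounded mu_haar _ q_ge0 q0_gt0.
move=> p p12 Hq; apply: norlund_unbounded => // n.
have [->|n0] := posnP n; first by rewrite /norlund_weight big_geq// mul0r.
case: Hq => [[_ /(_ n n0)]|qdec].
  have Q0 := norlund_weight_gt0 q_ge0 q0_gt0 n0.
  by rewrite ler_pdivlMr// ler_pdivrMl ?ltr0n.
rewrite /norlund_weight (@le_trans _ _ (\sum_(0 <= k < n) q 0%N))//.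
  by apply: ler_sum => k _; exact: qdec.
by rewrite sumr_const_nat subn0 mulr_natl.
Qed.
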